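(* Let $M\in GL_n$ be a semisimple matrix each of whose (possible) negative eigenvalues has even multiplicity, let $\mathcal{J}_M$ be its real Jordan standard form, and let $C\in GL_n$ be such that $M=C\mathcal{J}_MC^{-1}$. Fix any admissible indices $(u_1,\dots,u_p)$, $(\mu_{11},\dots,\mu_{1s_1};\dots;\mu_{r1},\dots,\mu_{rs_r})$ (that is, $0\le u_i\le h_i$ and $0\le \mu_{lt}\le m_{lt}$) and let $\widetilde{\mathcal{J}}$ be the RJA form common to all $Y\in \mathcal{SR}(M)_{(u_1,\dots,u_p)}^{(\mu_{11},\dots,\mu_{1s_1};\dots;\mu_{r1},\dots,\mu_{rs_r})}$. Then $$\mathcal{SR}(M)_{(u_1,\dots,u_p)}^{(\mu_{11},\dots,\mu_{1s_1};\dots;\mu_{r1},\dots,\mu_{rs_r})}=\{CX\widetilde{\mathcal{J}}X^{-1}C^{-1}: X\in\mathcal{C}_{\mathcal{J}_M}\}=\widehat{\Gamma}_C\big(\{X\widetilde{\mathcal{J}}X^{-1}:X\in\mathcal{C}_{\mathcal{J}_M}\}\big).$$ Moreover $\mathcal{SR}(M)_{(u_1,\dots,u_p)}^{(\mu_{11},\dots,\mu_{1s_1};\dots;\mu_{r1},\dots,\mu_{rs_r})}$ is a closed embedded submanifold of $GL_n$, diffeomorphic to the homogeneous space $\dfrac{\mathcal{C}_{\mathcal{J}_M}}{\mathcal{C}_{\widetilde{\mathcal{J}}}}$.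
   Context: $GL_n$ is the group of real non-singular $n\times n$ matrices. A real matrix is semisimple if it is diagonalizable over $\mathbb{C}$. For $B\in GL_n$, $\mathcal{C}_B:=\{X\in GL_n: BX=XB\}$, a closed Lie subgroup of $GL_n$. For $C\in GL_n$, $\widehat{\Gamma}_C(X):=CXC^{-1}$ on $GL_n$. $E_\theta:=\begin{pmatrix}\cos\theta&-\sin\theta\\ \sin\theta&\cos\theta\end{pmatrix}$. $\oplus$ denotes block-diagonal sum of matrices, $B^{\oplus m}$ is $B\oplus\dots\oplus B$ ($m$ times); blocks of size $0$ are omitted. Eigenvalues of $M$. Let $M\in GL_n$ be semisimple with every negative eigenvalue of even multiplicity. Its eigenvalues are denoted as follows: (i) distinct positive eigenvalues $\lambda_1<\dots<\lambda_p$ ($p\ge0$) with multiplicities $h_1,\dots,h_p$; (ii) distinct non-real eigenvalues $\rho_{lt}\exp(\pm\mathbf{i}\theta_l)$, $1\le l\le r$, $1\le t\le s_l$ ($r\ge0$), both $\rho_{lt}\exp(\pm\mathbf{i}\theta_l)$ having multiplicity $m_{lt}$, where $0<\theta_1<\dots<\theta_r<\pi$ and $0<\rho_{l1}<\dots<\rho_{ls_l}$ for each $l$; (iii) distinct negative eigenvalues $-\zeta_1>\dots>-\zeta_q$ ($q\ge0$) with multiplicities $2k_1,\dots,2k_q$. The real Jordan standard form (RJS form) of $M$ is $$\mathcal{J}_M:=\Big(\bigoplus_{i=1}^p\lambda_iI_{h_i}\Big)\oplus\Big(\bigoplus_{l=1}^r\bigoplus_{t=1}^{s_l}\rho_{lt}E_{\theta_l}^{\oplus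 m_{lt}}\Big)\oplus\Big(\bigoplus_{i=1}^q(-\zeta_i)I_{2k_i}\Big);$$ there always exists $C\in GL_n$ with $M=C\mathcal{J}_MC^{-1}$. $\mathcal{SR}(M)$ is the set of all real $n\times n$ matrices $Y$ with $Y^2=M$ (each such $Y$ is semisimple). For integers $0\le u_i\le h_i$, $0\le\mu_{lt}\le m_{lt}$, put $v_i=h_i-u_i$, $\nu_{lt}=m_{lt}-\mu_{lt}$; then $\mathcal{SR}(M)_{(u_1,\dots,u_p)}^{(\mu_{11},\dots,\mu_{1s_1};\dots;\mu_{r1},\dots,\mu_{rs_r})}$ is the set of $Y\in\mathcal{SR}(M)$ whose eigenvalues are: $\sqrt{\lambda_i}$ with multiplicity $u_i$ and $-\sqrt{\lambda_i}$ with multiplicity $v_i$; $\sqrt{\rho_{lt}}\exp(\pm\mathbf{i}\theta_l/2)$ both with multiplicity $\mu_{lt}$ and $\sqrt{\rho_{lt}}\exp(\pm\mathbf{i}(\theta_l/2-\pi))$ both with multiplicity $\nu_{lt}$; $\pm\sqrt{\zeta_i}\,\mathbf{i}$ both with multiplicity $k_i$. All such $Y$ are similar over $\mathbb{R}$ to the same matrix, called their real Jordan auxiliary form (RJA form): $$\widetilde{\mathcal{J}}:=\Big[\bigoplus_{i=1}^p\sqrt{\lambda_i}\,(I_{u_i}\oplus(-I_{v_i}))\Big]\oplus\Big[\bigoplus_{l=1}^r\bigoplus_{t=1}^{s_l}\sqrt{\rho_{lt}}\,\big(E_{\theta_l/2}^{\oplus\mu_{lt}}\oplus E_{(\theta_l/2-\pi)}^{\oplus\nu_{lt}}\big)\Big]\oplus\Big[\bigoplus_{i=1}^q\sqrt{\zeta_i}\,E_{\pi/2}^{\oplus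 k_i}\Big].$$ It satisfies $\widetilde{\mathcal{J}}^2=\mathcal{J}_M$, so $\mathcal{C}_{\widetilde{\mathcal{J}}}\subseteq\mathcal{C}_{\mathcal{J}_M}$. One or both families of indices may be empty (when $p=0$ and/or $r=0$), in which case they are omitted from the notation. *)

(* Defs.v *)
From HB Require Import structures.
From mathcomp Require Import all_boot all_order all_algebra.
From mathcomp Require Import all_classical all_reals all_analysis.
From mathcomp Require Import complex.
Import Order.TTheory GRing.Theory Num.Theory.
Import numFieldNormedType.Exports.

Set Implicit Arguments.
Unset Strict Implicit.
Unset Printing Implicit Defensive.

Local Open Scope classical_set_scope.
Local Open Scope ring_scope.
Local Open Scope complex_scope.
Local Open Scope quotient_scope.

Section Smooth.
Variables (R : realType) (V W : normedModType R).

(* Only used on open sets [U] of finite-dimensional spaces, where this is the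
   usual notion of a map of class C^k. *)
Fixpoint class_C (k : nat) (U : set V) (f : V -> W) : Prop :=
  if k is k'.+1 then
    (forall x, U x -> differentiable f x) /\
    (forall v : V, class_C k' U (fun x => derive f x v))
  else forall x, U x -> {for x, continuous f}.

Definition smooth_on (U : set V) (f : V -> W) : Prop :=
  forall k, class_C k U f.

End Smooth.

Definition diffeo_on (R : realType) (V W : normedModType R)
    (U : set V) (f : V -> W) (g : W -> V) : Prop :=
  [/\ open U, open (f @` U), smooth_on U f, smooth_on (f @` U) g &
      forall x, U x -> g (f x) = x].

Section Manifold.
Variable R : realType.

(* [chart_inv c] is only relevant on the image of [chart_dom c]. *)
Record chart (T : topologicalType) (d : nat) := Chart {
  chart_dom : set T;
  chart_map : T -> 'rV[R]_d;
  chart_inv : 'rV[R]_d -> T }.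

Definition chart_image (T : topologicalType) d (c : chart T d) : set 'rV[R]_d :=
  chart_map c @` chart_dom c.

Definition is_chart (T : topologicalType) d (c : chart T d) : Prop :=
  [/\ open (chart_dom c), open (chart_image c),
      forall x, chart_dom c x -> {for x, continuous (chart_map c)},
      forall y, chart_image c y -> {for y, continuous (chart_inv c)} &
      forall x, chart_dom c x -> chart_inv c (chart_map c x) = x].

Definition smooth_atlas (T : topologicalType) d (A : set (chart T d)) : Prop :=
  [/\ forall c, A c -> is_chart c,
      forall x, exists2 c, A c & chart_dom c x &
      forall c c', A c -> A c' ->
        smooth_on (chart_map c @` (chart_dom c `&` chart_dom c'))
                  (chart_map c' \o chart_inv c)].

Definition smooth_manifold (T : topologicalType) d (A : set (chart T d)) : Prop :=
  [/\ hausdorff_space T, @second_countable T & smooth_atlas A].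

Definition smooth_at (T T' : topologicalType) d d'
    (A : set (chart T d)) (A' : set (chart T' d')) (f : T -> T') (x : T) : Prop :=
  exists c c' N,
    [/\ A c /\ A' c', open N /\ N x, N `<=` chart_dom c,
        f @` N `<=` chart_dom c' &
        smooth_on (chart_map c @` N) (chart_map c' \o f \o chart_inv c)].

Definition smooth_map (T T' : topologicalType) d d'
    (A : set (chart T d)) (A' : set (chart T' d')) (f : T -> T') : Prop :=
  forall x, smooth_at A A' f x.

Definition diffeomorphic (T T' : topologicalType) d d'
    (A : set (chart T d)) (A' : set (chart T' d')) : Prop :=
  exists f : T -> T', exists g : T' -> T,
    [/\ cancel f g, cancel g f, smooth_map A A' f & smooth_map A' A g].

(* The charts of the subspace [S] induced by slice charts of the open set [O] of
   [V]: [U] is the domain of a chart [Phi] of [O] for which [S `&` U] is the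
   zero set of the last [e] coordinates (so that [d + e] is the dimension of
   [V]); the induced chart of [S] retains the first [d] coordinates. *)
Definition slice_charts (V : normedModType R) (O S : set V) (d : nat) :
    set (chart S d) :=
  [set c : chart S d | is_chart c /\
    exists e (U : set V) (Phi : V -> 'rV[R]_(d + e)) (Psi : 'rV[R]_(d + e) -> V),
    [/\ U `<=` O, diffeo_on U Phi Psi,
        S `&` U = [set x | U x /\ rsubmx (Phi x) = 0],
        chart_dom c = set_val @^-1` U &
        forall x : S, chart_dom c x -> chart_map c x = lsubmx (Phi (set_val x))]].

Arguments slice_charts {V} O S d.

Definition embedded_submanifold (V : normedModType R) (O S : set V) (d : nat) :
    Prop :=
  [/\ open O, S `<=` O &
      forall x : S, exists2 c, slice_charts O S d c & chart_dom c x].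

End Manifold.

Arguments slice_charts {R V} O S d.

Section Centralizer.
Variables (R : realType) (n : nat).
Implicit Types A B C X Y : 'M[R]_n.

Definition GL : set 'M[R]_n := [set X | X \in unitmx].

Definition centralizer B : set 'M[R]_n := [set X | GL X /\ B *m X = X *m B].

Definition Gamma_hat C X : 'M[R]_n := C *m X *m invmx C.

Lemma centralizer1 B : centralizer B 1%:M.
Proof. by split; rewrite /GL /= ?unitmx1// mulmx1 mul1mx. Qed.

Lemma centralizerM B X Y :
  centralizer B X -> centralizer B Y -> centralizer B (X *m Y).
Proof.
move=> [uX cX] [uY cY]; split; first by rewrite /GL /= unitmx_mul; apply/andP.
by rewrite mulmxA cX -!mulmxA cY.
Qed.

Lemma centralizerV B X : centralizer B X -> centralizer B (invmx X).
Proof.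
move=> [uX cX]; split; first by rewrite /GL /= unitmx_inv.
apply: (can_inj (mulKmx uX)); apply: (can_inj (mulmxK uX)).
by rewrite (mulKVmx uX) -!mulmxA (mulVmx uX) mulmx1 -cX.
Qed.

Variables A B : 'M[R]_n.

(* [X] and [Y] define the same left coset of the centralizer of [B]. *)
Definition coset_rel : rel (centralizer A) :=
  fun X Y : centralizer A => `[< centralizer B (invmx (set_val X) *m set_val Y) >].

Lemma centralizer_unit (X : centralizer A) : set_val X \in unitmx.
Proof. by have [] := set_valP X. Qed.

Local Hint Resolve centralizer_unit : core.

Lemma coset_rel_refl : reflexive coset_rel.
Proof.
by move=> X; apply/asboolP; rewrite mulVmx//; exact: centralizer1.
Qed.

Lemma coset_rel_sym : symmetric coset_rel.
Proof.
suff H (X Y : centralizer A) : coset_rel X Y -> coset_rel Y X by move=> X Y; apply/idP/idP => /H.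
move=> /asboolP XY; apply/asboolP.
suff <- : invmx (invmx (set_val X) *m set_val Y) = invmx (set_val Y) *m set_val X.
  exact: centralizerV.
have uXY : invmx (set_val X) *m set_val Y \in unitmx by case: XY.
apply: (can_inj (mulKmx uXY)); rewrite mulmxV// mulmxA.
by rewrite -[X in _ = X *m _]mulmxA mulmxV// mulmx1 mulVmx.
Qed.

Lemma coset_rel_trans : transitive coset_rel.
Proof.
move=> Y X Z /asboolP XY /asboolP YZ; apply/asboolP.
have := centralizerM XY YZ.
by rewrite -mulmxA (mulmxA (set_val Y)) mulmxV// mul1mx.
Qed.

Canonical coset_equiv :=
  EquivRel coset_rel coset_rel_refl coset_rel_sym coset_rel_trans.

(* The space of left cosets, with the quotient topology; its points are the
   cosets of [centralizer B] when the latter is a subset of [centralizer A]. *)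
Definition homogeneous_space : topologicalType :=
  quotient_topology {eq_quot coset_equiv}.

Definition coset_proj : centralizer A -> homogeneous_space :=
  \pi_(quotient_topology {eq_quot coset_equiv}).

(* The smooth structure of the homogeneous space is the unique one for which
   the projection is smooth and has smooth local sections near every point
   (equivalently, is a smooth submersion); [dG] is the dimension of the
   submanifold [centralizer A] of [GL]. *)
Definition homogeneous_structure (dG d : nat)
    (K : set (chart R homogeneous_space d)) : Prop :=
  [/\ smooth_manifold K,
      smooth_map (slice_charts GL (centralizer A) dG) K coset_proj &
      forall y, exists (N : set homogeneous_space)
                       (s : homogeneous_space -> centralizer A),
        [/\ open N, N y,
            forall z, N z ->
              smooth_at K (slice_charts GL (centralizer A) dG) s z &
            forall z, N z -> coset_proj (s z) = z]].

End Centralizer.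

Arguments GL R n : clear implicits.

Section Spectrum.
Variables (R : realType) (n : nat).
Implicit Types M Y : 'M[R]_n.

Definition complexify M : 'M[R[i]]_n := map_mx (real_complex R) M.

Definition semisimple M : Prop := diagonalizable (complexify M).

(* The complex eigenvalues of [M], repeated according to their algebraic
   multiplicities, are the elements of [s]. *)
Definition has_spectrum M (s : seq R[i]) : Prop :=
  forall z, mup z (char_poly (complexify M)) = count_mem z s.

Lemma has_spectrum_size M s : has_spectrum M s -> size s = n.
Proof.
move=> sM; have [r rE] := closed_field_poly_normal (char_poly (complexify M)).
move: rE; rewrite (monicP (char_poly_monic _)) scale1r => rE.
have /perm_size -> : perm_eq s r.
  by apply/allP => z _ /=; rewrite -sM rE mu_prod_XsubC.
by apply: succn_inj; rewrite -(size_prod_XsubC r id) -rE size_char_poly.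
Qed.

Definition negative_eigenvalues_even M : Prop :=
  forall a : R, a < 0 -> eigenvalue M a -> ~~ odd (mup a (char_poly M)).

Definition SR M : set 'M[R]_n := [set Y | Y *m Y = M].

End Spectrum.

Definition polar (R : realType) (r t : R) : R[i] := (r * cos t) +i* (r * sin t).

Record eigen_data (R : realType) := EigenData {
  pos_num : nat;
  lam : 'I_pos_num -> R;
  hmul : 'I_pos_num -> nat;
  arg_num : nat;
  theta : 'I_arg_num -> R;
  mod_num : 'I_arg_num -> nat;
  rho : forall l, 'I_(mod_num l) -> R;
  mmul : forall l, 'I_(mod_num l) -> nat;
  neg_num : nat;
  zeta : 'I_neg_num -> R;
  (* half of the multiplicity of the eigenvalue [- zeta i] *)
  kmul : 'I_neg_num -> nat }.

Arguments lam {R e} _.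
Arguments hmul {R e} _.
Arguments theta {R e} _.
Arguments mod_num {R e} _.
Arguments rho {R e l} _.
Arguments mmul {R e l} _.
Arguments zeta {R e} _.
Arguments kmul {R e} _.

Section Jordan.
Variable R : realType.
Variable D : eigen_data R.

Definition increasing m (f : 'I_m -> R) : Prop :=
  forall i j : 'I_m, (i < j)%N -> f i < f j.

Definition eigen_data_wf : Prop :=
  [/\ [/\ increasing (@lam R D), forall i : 'I_(pos_num D), 0 < lam i &
          forall i : 'I_(pos_num D), (0 < hmul i)%N],
      [/\ increasing (@theta R D),
          forall l : 'I_(arg_num D), 0 < theta l < pi &
          forall l : 'I_(arg_num D), (0 < mod_num l)%N],
      (forall l : 'I_(arg_num D),
        [/\ increasing (@rho R D l), forall t : 'I_(mod_num l), 0 < rho t &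
            forall t : 'I_(mod_num l), (0 < mmul t)%N]) &
      [/\ increasing (@zeta R D), forall i : 'I_(neg_num D), 0 < zeta i &
          forall i : 'I_(neg_num D), (0 < kmul i)%N]].

Definition eigenvalues : seq R[i] :=
  flatten [seq nseq (hmul i) (lam i)%:C | i : 'I_(pos_num D)] ++
  flatten [seq flatten [seq nseq (mmul t) (polar (rho t) (theta l)) ++
                            nseq (mmul t) (polar (rho t) (- theta l))
                       | t : 'I_(mod_num l)] | l : 'I_(arg_num D)] ++
  flatten [seq nseq (2 * kmul i) (- zeta i)%:C | i : 'I_(neg_num D)].

Definition rotation_mx (t : R) : 'M[R]_2 :=
  \matrix_(i < 2, j < 2)
    if i == j then cos t else if (i < j)%N then - sin t else sin t.

Definition dsum a b (X : 'M[R]_a) (Y : 'M[R]_b) : 'M[R]_(a + b) :=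
  block_mx X 0 0 Y.

Definition RJS_order : nat :=
  \sum_(i < pos_num D) hmul i +
  (\sum_(l < arg_num D) \sum_(t < mod_num l) \sum_(j < mmul t) 2 +
   \sum_(i < neg_num D) 2 * kmul i).

Definition RJS_blocks : 'M[R]_RJS_order :=
  dsum (\mxdiag_(i < pos_num D) (lam i)%:M)
    (dsum
      (\mxdiag_(l < arg_num D) \mxdiag_(t < mod_num l)
         (rho t *: \mxdiag_(j < mmul t) rotation_mx (theta l)))
      (\mxdiag_(i < neg_num D) (- zeta i)%:M)).

Lemma size_flatten_image (I : finType) (T : Type) (f : I -> seq T) :
  size (flatten [seq f i | i : I]) = (\sum_i size (f i))%N.
Proof. by rewrite size_flatten /shape sumnE big_map big_image. Qed.

Lemma RJS_order_eq n (M : 'M[R]_n) :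
  has_spectrum M eigenvalues -> RJS_order = n.
Proof.
move=> /has_spectrum_size <-; rewrite /eigenvalues !size_cat.
rewrite !size_flatten_image.
congr (_ + (_ + _))%N; apply: eq_bigr => i _; rewrite ?size_nseq//.
rewrite size_flatten_image; apply: eq_bigr => t _.
by rewrite size_cat !size_nseq sum_nat_const card_ord muln2 addnn.
Qed.

(* [conform_mx] is used here and below only to transport a matrix along the
   equality of its order with [n] (when [D] describes the eigenvalues of a matrix
   of order [n]: see [RJS_order_eq] and [RJA_order_eq]). *)
Definition RJS n : 'M[R]_n := conform_mx 0 RJS_blocks.

Section Auxiliary.
Variable u : 'I_(pos_num D) -> nat.
Variable mu : forall l : 'I_(arg_num D), 'I_(mod_num l) -> nat.

Definition admissible : Prop :=
  (forall i, (u i <= hmul i)%N) /\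
  (forall l (t : 'I_(mod_num l)), (mu t <= mmul t)%N).

Definition root_eigenvalues : seq R[i] :=
  flatten [seq nseq (u i) (Num.sqrt (lam i))%:C ++
               nseq (hmul i - u i) (- Num.sqrt (lam i))%:C
          | i : 'I_(pos_num D)] ++
  flatten [seq flatten [seq
      nseq (mu t) (polar (Num.sqrt (rho t)) (theta l / 2)) ++
      nseq (mu t) (polar (Num.sqrt (rho t)) (- (theta l / 2))) ++
      nseq (mmul t - mu t) (polar (Num.sqrt (rho t)) (theta l / 2 - pi)) ++
      nseq (mmul t - mu t) (polar (Num.sqrt (rho t)) (- (theta l / 2 - pi)))
    | t : 'I_(mod_num l)] | l : 'I_(arg_num D)] ++
  flatten [seq nseq (kmul i) (0 +i* Num.sqrt (zeta i)) ++
               nseq (kmul i) (0 -i* Num.sqrt (zeta i))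
          | i : 'I_(neg_num D)].

Definition SR_index n (M : 'M[R]_n) : set 'M[R]_n :=
  [set Y | SR M Y /\ has_spectrum Y root_eigenvalues].

Definition RJA_order : nat :=
  \sum_(i < pos_num D) (u i + (hmul i - u i)) +
  (\sum_(l < arg_num D) \sum_(t < mod_num l)
      (\sum_(j < mu t) 2 + \sum_(j < mmul t - mu t) 2) +
   \sum_(i < neg_num D) \sum_(j < kmul i) 2).

Definition RJA_blocks : 'M[R]_RJA_order :=
  dsum (\mxdiag_(i < pos_num D)
          (Num.sqrt (lam i) *:
             dsum (1%:M : 'M[R]_(u i)) (- 1%:M : 'M[R]_(hmul i - u i))))
    (dsum
      (\mxdiag_(l < arg_num D) \mxdiag_(t < mod_num l)
         (Num.sqrt (rho t) *:
            dsum (\mxdiag_(j < mu t) rotation_mx (theta l / 2))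
                 (\mxdiag_(j < mmul t - mu t) rotation_mx (theta l / 2 - pi))))
      (\mxdiag_(i < neg_num D)
         (Num.sqrt (zeta i) *: \mxdiag_(j < kmul i) rotation_mx (pi / 2)))).

Lemma RJA_order_eq : admissible -> RJA_order = RJS_order.
Proof.
move=> [hu hmu]; congr (_ + (_ + _))%N; apply: eq_bigr => i _.
- by rewrite subnKC.
- apply: eq_bigr => t _.
  by rewrite !sum_nat_const !card_ord -mulnDl subnKC.
- by rewrite sum_nat_const card_ord mulnC.
Qed.

Definition RJA n : 'M[R]_n := conform_mx 0 RJA_blocks.

End Auxiliary.
End Jordan.

(* Main.v *)
Require Import Defs.
From HB Require Import structures.
From mathcomp Require Import all_boot all_order all_algebra.
From mathcomp Require Import all_classical all_reals all_analysis.
From mathcomp Require Import complex.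
From mathcomp Require Import perm ring.
Import Order.TTheory GRing.Theory Num.Theory.
Import numFieldNormedType.Exports.

(** Write A for the Jordan form of M and J for the auxiliary form, so that
    J^2 = A.

    The equality of sets is linear algebra. A square root Y of M is
    diagonalizable over the complex numbers, because M is and is invertible
    ([diagonalizable_sqrt]). If Y has the prescribed spectrum it is therefore
    similar over the complex numbers, hence over the real ones
    ([real_similar]), to C J C^-1, which is another square root of M; a matrix
    that conjugates C^-1 Y C to J must commute with the common square A
    ([SR_spectrum_orbit]). Computing J^2 and the spectrum of J is a matter of
    block-diagonal sums ([RJA_sqr], [RJA_spectrum]).

    The geometric part holds for any invertible J, and rests on two explicit
    formulas that replace the inverse function theorem. The first is the Cayley
    transform K = (Y - J) (Y + J)^-1, a rational diffeomorphism between open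
    sets of matrices that turns the equation Y^2 = J^2 into the linear one
    J K + K J = 0. It provides slice charts of the orbit ([orbit_chart]). The
    second is the identity Y (Y + J) = (Y + J) J, valid whenever Y^2 = J^2
    ([sqr_conj_add]): it shows that every square root of A near J is conjugate
    to J under the centralizer of A, by a matrix that depends smoothly on Y.
    This gives smooth local sections of the orbit map X |-> X J X^-1, and also
    the fact that the spectrum is locally constant on the square roots of M, so
    that those with a given spectrum form a closed set ([closed_SR_spectrum]).

    The centralizer of A is open in a linear space, so it has a global chart
    ([centralizer_chart]). The orbit map induces a homeomorphism from the coset
    space to the orbit, along which the charts of the orbit can be carried
    ([homogeneous_structure_exists]). For any smooth structure on the coset
    space for which the projection is smooth and has smooth local sections, this
    homeomorphism is a diffeomorphism: it is locally the orbit map composed with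
    a section of the projection, and its inverse is locally the projection
    composed with a section of the orbit map ([smooth_coset_orbit],
    [smooth_orbit_coset]). *)

Set Implicit Arguments.
Unset Strict Implicit.
Unset Printing Implicit Defensive.

Local Open Scope classical_set_scope.
Local Open Scope ring_scope.

(** * Maps of class C^k between normed modules *)

Lemma near_eq_continuous (T T' : topologicalType) (f g : T -> T') (x : T) :
  (\forall y \near x, f y = g y) ->
  {for x, continuous f} -> {for x, continuous g}.
Proof.
move=> fg; rewrite /prop_for /continuous_at (nbhs_singleton fg).
by move=> cf; apply: cvg_trans cf; exact: near_eq_cvg.
Qed.

Section LocalSmoothness.
Variables (R : realType) (V W : normedModType R).
Implicit Types (f g : V -> W) (U : set V) (x v : V).

(** Adding to [f] a map that vanishes near [x], hence has zero differential
    there, keeps it differentiable. *)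
Lemma near_eq_differentiable f g x :
  (\near x, f x = g x) -> differentiable f x -> differentiable g x.
Proof.
move=> fg df; have fgx : f x = g x by exact: (nbhs_singleton fg).
pose h := g - f; have -> : g = f + h by rewrite /h addrC subrK.
apply: differentiableD => //.
have c0 : continuous (\0 : {linear V -> W}) by move=> y; exact: cvg_cst.
have fg0 : \forall y \near (0 : V), f (y + x) = g (y + x).
  by rewrite (near_shift x)/=; near do rewrite /= sub0r addrNK.
have h0 : h \o shift x = cst (h x) + (\0 : {linear V -> W}) +o_ (0 : V) id.
  apply/eqaddoP => e e0; near=> y.
  have -> : (h \o shift x - (cst (h x) + (\0 : {linear V -> W}))) y = 0.
    rewrite /h !fctE /= fgx subrr addr0 subr0 (near fg0 y) ?subrr//.
  by rewrite normr0 mulr_ge0// ltW.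
by apply/diff_locallyP; rewrite (diff_unique c0 h0); split.
Unshelve. all: by end_near. Qed.

Lemma open_near_eq U f g x : open U -> (forall y, U y -> f y = g y) -> U x ->
  \near x, f x = g x.
Proof.
by move=> oU fg Ux; apply: filterS (open_nbhs_nbhs (conj oU Ux)) => y /fg.
Qed.

(** [class_C] only constrains derivatives at the points of [U]; openness of
    [U] is what lets two maps that agree on [U] have the same derivatives
    there. Every closure property below goes through this lemma, because a
    derivative is computed by a formula that holds on [U] only. *)
Lemma class_C_ext k U f g : open U -> (forall x, U x -> f x = g x) ->
  class_C k U f -> class_C k U g.
Proof.
move=> oU; elim: k f g => [|k IHk] f g fg /=.
  by move=> cf x Ux; exact: near_eq_continuous (open_near_eq oU fg Ux) (cf x Ux).
move=> [df Df]; split=> [x Ux|v].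
  exact: near_eq_differentiable (open_near_eq oU fg Ux) (df x Ux).
apply: IHk (Df v) => x Ux; apply: near_eq_derive.
exact: open_near_eq fg Ux.
Qed.

Lemma class_C_continuous k U f :
  class_C k U f -> forall x, U x -> {for x, continuous f}.
Proof.
by case: k => [//|k] [df _] x Ux; exact/differentiable_continuous/df.
Qed.

Lemma class_C_pred k U f : class_C k.+1 U f -> class_C k U f.
Proof.
elim: k f => [|k IHk] f; first exact: class_C_continuous.
by move=> [df Df]; split=> // v; apply: IHk; exact: Df.
Qed.

Lemma class_C_subset k U U' f : U' `<=` U -> class_C k U f -> class_C k U' f.
Proof.
move=> sU; elim: k f => [|k IHk] f /=; first by move=> cf x /sU; exact: cf.
by move=> [df Df]; split=> [x /sU|v]; [exact: df|exact/IHk/Df].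
Qed.

Lemma class_C_cst k U (w : W) : class_C k U (cst w).
Proof.
elim: k w => [|k IHk] w /=; first by move=> x _; exact: cvg_cst.
split=> [x _|v]; first exact: differentiable_cst.
by rewrite (_ : (fun _ => _) = cst 0) //; apply/funext => x; exact: derive_cst.
Qed.

Lemma class_C_linear k U (L : {linear V -> W}) : continuous L -> class_C k U L.
Proof.
move=> cL; case: k => [|k] /=; first by move=> x _; exact: cL.
split=> [x _|v]; first exact: linear_differentiable.
rewrite (_ : (fun _ => _) = cst (L v)); first exact: class_C_cst.
apply/funext => x; rewrite deriveE ?diff_lin//.
exact: linear_differentiable.
Qed.

Lemma class_CD k U f g : open U -> class_C k U f -> class_C k U g ->
  class_C k U (fun x => f x + g x).
Proof.
move=> oU; elim: k f g => [|k IHk] f g /=.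
  by move=> cf cg x Ux; apply: cvgD; [exact: cf|exact: cg].
move=> [df Df] [dg Dg]; split=> [x Ux|v].
  by apply: differentiableD; [exact: df|exact: dg].
apply: class_C_ext (IHk _ _ (Df v) (Dg v)) => // x Ux.
by rewrite -deriveD//; apply: diff_derivable; [exact: df|exact: dg].
Qed.

Lemma class_C_sum (I : Type) (r : seq I) k U (F : I -> V -> W) : open U ->
  (forall i, class_C k U (F i)) -> class_C k U (fun x => \sum_(i <- r) F i x).
Proof.
move=> oU cF; elim: r => [|i r IHr].
  by apply: class_C_ext (class_C_cst k U 0) => // x Ux; rewrite big_nil.
apply: class_C_ext (class_CD oU (cF i) IHr) => // x Ux.
by rewrite big_cons.
Qed.

End LocalSmoothness.

Section ScaleSmoothness.
Variables (R : realType) (V W W' : normedModType R).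
Implicit Types (U : set V).

Lemma class_C_linear_comp k U (f : V -> W) (L : {linear W -> W'}) : open U ->
  continuous L -> class_C k U f -> class_C k U (L \o f).
Proof.
move=> oU cL; elim: k f => [|k IHk] f /=.
  by move=> cf x Ux; apply: continuous_comp; [exact: cf|exact: cL].
move=> [df Df]; split=> [x Ux|v].
  by apply: differentiable_comp; [exact: df|exact: linear_differentiable].
apply: class_C_ext (IHk _ (Df v)) => // x Ux; have dfx := df x Ux.
have dL : differentiable L (f x) by exact: linear_differentiable.
rewrite /= [in RHS]deriveE; last exact: differentiable_comp.
by rewrite deriveE// (diff_comp dfx dL)/= diff_lin.
Qed.

Let scale_is_bilinear :
  bilinear_for (GRing.Scale.Law.clone _ _ *:%R _) (GRing.Scale.Law.clone _ _ *:%R _)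
    (@GRing.scale R W).
Proof.
split=> [w a b c|a b u v] /=; first by rewrite scalerDl scalerA.
by rewrite scalerDr !scalerA mulrC.
Qed.

HB.instance Definition _ :=
  bilinear_isBilinear.Build R R W W _ _ (@GRing.scale R W) scale_is_bilinear.

(** The product rule, from the differential of the bilinear map
    (a, w) |-> a *: w composed with the pair of the two maps. *)
Lemma differentiable_scale (a : V -> R) (h : V -> W) x :
  differentiable a x -> differentiable h x ->
  is_diff x (fun y => a y *: h y)
    (fun v => a x *: 'd h x v + 'd a x v *: h x).
Proof.
move=> da dh; pose B (p : R * W) := p.1 *: p.2.
have cB : continuous B by exact: scale_continuous.
have dB : differentiable B (a x, h x).
  exact: (@differentiable_bilin _ _ _ _ (@GRing.scale R W)).
have dah : differentiable (fun y => (a y, h y)) x by exact: differentiable_pair.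
apply: DiffDef; first exact: (differentiable_comp dah dB).
rewrite (_ : (fun y => _) = B \o (fun y => (a y, h y)))// (diff_comp dah dB).
apply/funext => v /=; rewrite diff_pair//=.
by rewrite (@diff_bilin _ _ _ _ (@GRing.scale R W)).
Qed.

(** Induction on [k]: by the product rule the derivative is a sum of two
    products whose factors are all at least of class C^(k-1). *)
Lemma class_C_scale k U (a : V -> R) (h : V -> W) : open U ->
  class_C k U a -> class_C k U h -> class_C k U (fun x => a x *: h x).
Proof.
move=> oU; elim: k a h => [|k IHk] a h.
  by move=> ca ch x Ux; apply: cvgZ; [exact: ca|exact: ch].
move=> ca ch; have [[da Da] [dh Dh]] := (ca, ch).
have dah x : U x -> is_diff x (fun y => a y *: h y)
    (fun v => a x *: 'd h x v + 'd a x v *: h x).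
  by move=> Ux; apply: differentiable_scale; [exact: da|exact: dh].
split=> [x /dah//|v].
have := class_CD oU (IHk _ _ (class_C_pred ca) (Dh v))
  (IHk _ _ (Da v) (class_C_pred ch)).
apply: class_C_ext => // x Ux; have dx := dah x Ux.
have [dax dhx] := (da x Ux, dh x Ux).
by rewrite [in RHS]deriveE// diff_val !deriveE.
Qed.

End ScaleSmoothness.

Section InverseSmoothness.
Variables (R : realType) (V : normedModType R).
Implicit Types (U : set V) (a b : V -> R).

Lemma class_CM k U a b : open U ->
  class_C k U a -> class_C k U b -> class_C k U (fun x => a x * b x).
Proof. exact: (@class_C_scale _ V R). Qed.

(** Induction on [k]: the derivative - (1/a)^2 * a' is a product of a'
    and of powers of 1/a, which is of class C^(k-1) by induction. *)
Lemma class_CV k U a : open U -> (forall x, U x -> a x != 0) ->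
  class_C k U a -> class_C k U (fun x => (a x)^-1).
Proof.
move=> oU a0; elim: k => [|k IHk].
  by move=> ca x Ux; apply: cvgV; [exact: a0|exact: ca].
move=> ca; have [da Da] := ca; have cV := IHk (class_C_pred ca).
split=> [x Ux|v].
  by apply: differentiableV; [exact: da|exact: a0].
have := class_CM oU (@class_C_cst R V R k U (-1)) (class_CM oU (class_CM oU cV cV) (Da v)).
apply: class_C_ext => // x Ux.
rewrite deriveV; [|exact: a0|exact/diff_derivable/da].
by rewrite /cst mulN1r scaleNr -expr2 exprVn.
Qed.

Lemma class_C_prod (I : Type) (r : seq I) k U (F : I -> V -> R) : open U ->
  (forall i, class_C k U (F i)) -> class_C k U (fun x => \prod_(i <- r) F i x).
Proof.
move=> oU cF; elim: r => [|i r IHr].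
  by apply: class_C_ext (@class_C_cst R V R k U 1) => // x Ux; rewrite big_nil.
apply: class_C_ext (class_CM oU (cF i) IHr) => // x Ux.
by rewrite big_cons.
Qed.

End InverseSmoothness.

(** * Smoothness of matrix operations and of composites *)

Section MatrixSmoothness.
Variables (R : realType) (V : normedModType R).
Implicit Types (U : set V).

Lemma linear_mx_continuous (W : normedModType R) m n
  (L : {linear 'M[R]_(m, n) -> W}) : continuous L.
Proof.
have -> : (L : _ -> _) = fun A => \sum_i \sum_j A i j *: L (delta_mx i j).
  apply/funext => A; rewrite {1}(matrix_sum_delta A) linear_sum.
  by apply: eq_bigr => i _; rewrite linear_sum; apply: eq_bigr => j _; rewrite linearZ.
move=> A; apply: (@class_C_continuous _ _ _ 0 setT) => //.
apply: class_C_sum => [|i]; first exact: openT.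
apply: class_C_sum => [|j]; first exact: openT.
apply: class_C_scale; [exact: openT| |exact: class_C_cst].
by move=> B _; exact: coord_continuous.
Qed.

(** The entry map, named so that it can carry a linear structure. *)
Definition mx_coord m n i j (A : 'M[R]_(m, n)) : R := A i j.

Fact mx_coord_is_linear m n i j : linear (@mx_coord m n i j : _ -> R^o).
Proof. by move=> a A B; rewrite /mx_coord !mxE. Qed.

HB.instance Definition _ m n i j := GRing.isLinear.Build R 'M[R]_(m, n) R^o _
  (@mx_coord m n i j) (mx_coord_is_linear i j).

(** A matrix is the sum of its entries times the elementary matrices, so that
    smoothness of matrix-valued maps reduces to the scalar case. *)
Lemma class_C_mxP m n k U (f : V -> 'M[R]_(m, n)) : open U ->
  class_C k U f <-> forall i j, class_C k U (fun x => f x i j : R).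
Proof.
move=> oU; split=> [cf i j|cf].
  apply: (class_C_linear_comp (L := @mx_coord m n i j) oU) cf.
  exact: coord_continuous.
have : class_C k U (fun x => \sum_i \sum_j f x i j *: delta_mx i j : 'M[R]_(m, n)).
  apply: class_C_sum => // i; apply: class_C_sum => // j.
  by apply: class_C_scale => //; exact: class_C_cst.
by apply: class_C_ext => // x _; rewrite -matrix_sum_delta.
Qed.

Lemma class_C_mulmx m n p k U (f : V -> 'M[R]_(m, n)) (g : V -> 'M[R]_(n, p)) :
  open U -> class_C k U f -> class_C k U g ->
  class_C k U (fun x => f x *m g x).
Proof.
move=> oU /(class_C_mxP _ _ oU) cf /(class_C_mxP _ _ oU) cg.
apply/class_C_mxP => // i j.
have : class_C k U (fun x => \sum_l f x i l * g x l j : R).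
  by apply: class_C_sum => // l; apply: class_CM.
by apply: class_C_ext => // x _; rewrite mxE.
Qed.

Lemma class_C_det n k U (f : V -> 'M[R]_n) : open U -> class_C k U f ->
  class_C k U (fun x => \det (f x) : R).
Proof.
move=> oU /(class_C_mxP _ _ oU) cf.
apply: class_C_sum => // s; apply: class_CM => //; first exact: class_C_cst.
exact: class_C_prod.
Qed.

(** Cramer's rule: the entries of the adjugate are polynomials in those of
    the matrix, and the determinant does not vanish. *)
Lemma class_C_invmx n k U (f : V -> 'M[R]_n) : open U ->
  (forall x, U x -> f x \in unitmx) -> class_C k U f ->
  class_C k U (fun x => invmx (f x)).
Proof.
move=> oU uf cf.
have : class_C k U (fun x => (\det (f x))^-1 *: \adj (f x)).
  apply: class_C_scale => //.
    apply: class_CV => //; last exact: class_C_det.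
    by move=> x /uf; rewrite unitmxE unitfE.
  apply/class_C_mxP => // i j.
  have : class_C k U (fun x => cofactor (f x) j i : R).
    apply: class_CM => //; first exact: class_C_cst.
    apply: class_C_det => //; apply/class_C_mxP => // a b.
    have : class_C k U (fun x => f x (lift j a) (lift i b) : R).
      by move/(class_C_mxP _ _ oU) : cf.
    by apply: class_C_ext => // x _; rewrite !mxE.
  by apply: class_C_ext => // x _; rewrite !mxE.
by apply: class_C_ext => // x Ux; rewrite /invmx uf.
Qed.

(** The higher-order chain rule. The intermediate space is one of matrices, so
    that the derivative of the composite can be written with the partial
    derivatives of [g]: it is the sum over [i], [j] of
    (D_v f)_ij * (D_ij g o f), and induction applies to the second factor. *)
Lemma class_C_comp (W : normedModType R) m n k U (U' : set 'M[R]_(m, n))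
    (f : V -> 'M[R]_(m, n)) (g : 'M[R]_(m, n) -> W) :
  open U -> open U' -> (forall x, U x -> U' (f x)) ->
  class_C k U f -> class_C k U' g -> class_C k U (g \o f).
Proof.
move=> oU oU' fU; elim: k g => [|k IHk] g.
  move=> cf cg x Ux; apply: continuous_comp; first exact: cf.
  exact/cg/fU.
move=> cf cg; have [[df Df] [dg Dg]] := (cf, cg).
split=> [x Ux|v].
  by apply: differentiable_comp; [exact: df|exact/dg/fU].
have : class_C k U (fun x => \sum_i \sum_j
    ('D_v f x) i j *: 'D_(delta_mx i j) g (f x)).
  apply: class_C_sum => // i; apply: class_C_sum => // j.
  apply: class_C_scale => //; first exact: (class_C_mxP _ _ oU).1 (Df v) i j.
  exact: IHk (class_C_pred cf) (Dg _).
apply: class_C_ext => // x Ux.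
have [dfx dgx] := (df x Ux, dg _ (fU x Ux)).
rewrite [in RHS]deriveE; last exact: differentiable_comp.
rewrite (diff_comp dfx dgx)/= -(deriveE v dfx).
set B := 'D_v f x; rewrite [in RHS](matrix_sum_delta B) linear_sum.
apply: eq_bigr => i _; rewrite linear_sum; apply: eq_bigr => j _.
by rewrite linearZ/= deriveE.
Qed.

End MatrixSmoothness.

Section SmoothOn.
Variables (R : realType) (V W : normedModType R).
Implicit Types (U : set V).

Lemma smooth_on_ext U (f g : V -> W) : open U -> (forall x, U x -> f x = g x) ->
  smooth_on U f -> smooth_on U g.
Proof. by move=> oU fg sf k; apply: class_C_ext fg (sf k). Qed.

Lemma smooth_on_subset U U' (f : V -> W) : U' `<=` U ->
  smooth_on U f -> smooth_on U' f.
Proof. by move=> sU sf k; exact: class_C_subset (sf k). Qed.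

Lemma smooth_on_linear m n U (L : {linear 'M[R]_(m, n) -> W})
    (f : V -> 'M[R]_(m, n)) :
  open U -> smooth_on U f -> smooth_on U (L \o f).
Proof.
move=> oU sf k; apply: class_C_linear_comp => //; exact: linear_mx_continuous.
Qed.

Lemma smooth_on_comp m n U (U' : set 'M[R]_(m, n)) (f : V -> 'M[R]_(m, n))
    (g : 'M[R]_(m, n) -> W) :
  open U -> open U' -> (forall x, U x -> U' (f x)) ->
  smooth_on U f -> smooth_on U' g -> smooth_on U (g \o f).
Proof. by move=> oU oU' fU sf sg k; exact: class_C_comp (sf k) (sg k). Qed.

Lemma smooth_on_id (U : set V) : smooth_on U id.
Proof. by move=> k; apply: (@class_C_linear _ _ _ _ _ idfun) => x. Qed.

Lemma smooth_on_continuous U (f : V -> W) x :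
  smooth_on U f -> U x -> {for x, continuous f}.
Proof. by move=> sf; exact: class_C_continuous (sf 0%N) x. Qed.

End SmoothOn.

Lemma open_unitmx (R : realType) n : open [set A : 'M[R]_n | A \in unitmx].
Proof.
have -> : [set A : 'M[R]_n | A \in unitmx] = (fun A => \det A : R) @^-1` [set x | x != 0].
  by apply/seteqP; split => A /=; rewrite unitmxE unitfE.
apply: open_comp; last first.
  rewrite (_ : mkset _ = ~` [set 0]); last by apply/seteqP; split=> x /= /eqP.
  exact/closed_openC/accessible_closed_set1/hausdorff_accessible/norm_hausdorff.
move=> A _; apply: (@class_C_continuous _ _ _ 0 setT) => //.
by apply: class_C_det; [exact: openT|exact: smooth_on_id 0%N].
Qed.

Section SmoothOnMatrix.
Variables (R : realType) (V : normedModType R) (U : set V) (oU : open U).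

Lemma smooth_on_cst (W : normedModType R) (w : W) : smooth_on U (fun=> w).
Proof. by move=> k; exact: class_C_cst. Qed.

Lemma smooth_onD (W : normedModType R) (f g : V -> W) :
  smooth_on U f -> smooth_on U g -> smooth_on U (fun x => f x + g x).
Proof. by move=> sf sg k; apply: class_CD. Qed.

Lemma smooth_onN m n (f : V -> 'M[R]_(m, n)) :
  smooth_on U f -> smooth_on U (fun x => - f x).
Proof. by move=> sf; apply: (smooth_on_linear -%R). Qed.

Lemma smooth_on_mulmx m n p (f : V -> 'M[R]_(m, n)) (g : V -> 'M[R]_(n, p)) :
  smooth_on U f -> smooth_on U g -> smooth_on U (fun x => f x *m g x).
Proof. by move=> sf sg k; apply: class_C_mulmx. Qed.

Lemma smooth_on_invmx n (f : V -> 'M[R]_n) : (forall x, U x -> f x \in unitmx) ->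
  smooth_on U f -> smooth_on U (fun x => invmx (f x)).
Proof. by move=> uf sf k; apply: class_C_invmx. Qed.

End SmoothOnMatrix.

Lemma open_preimage_unitmx (R : realType) (V : normedModType R) n
    (f : V -> 'M[R]_n) :
  smooth_on setT f -> open [set x | f x \in unitmx].
Proof.
move=> sf; rewrite (_ : mkset _ = f @^-1` [set A | A \in unitmx])//.
by apply: open_comp (@open_unitmx R n) => x _; exact: smooth_on_continuous sf _.
Qed.

(** * Charts, slice charts and maps between them *)

Section Charts.
Variables (R : realType) (T : topologicalType) (d : nat) (c : chart R T d).
Hypothesis cc : is_chart c.

(** On the image of the chart, the image of [N] is the preimage of [N] under
    the inverse of the chart. *)
Lemma open_chart_map_image N : open N -> N `<=` chart_dom c ->
  open (chart_map c @` N).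
Proof.
have [od oi cm ci cK] := cc => oN sN; rewrite openE => _ [x Nx <-].
have iy : chart_image c (chart_map c x) by exists x => //; exact: sN.
have nN : nbhs (chart_inv c (chart_map c x)) N.
  by rewrite cK; [exact: open_nbhs_nbhs|exact: sN].
have := open_nbhs_nbhs (conj oi iy); rewrite /interior.
apply: filter_app; move: (ci _ iy _ nN); rewrite /= nbhs_simpl /=.
apply: filterS => y Ny [z dz zy]; exists z => //.
by move: Ny; rewrite -zy /= cK.
Qed.

End Charts.

Lemma continuous_set_val (T X : topologicalType) (S : set X) (f : T -> S) x :
  {for x, continuous (set_val \o f)} -> {for x, continuous f}.
Proof.
move=> cf U [_ [[W oW <-] Wfx] sU]; apply: filterS sU _.
by apply: cf; exact: open_nbhs_nbhs.
Qed.

Lemma set_val_continuous (X : topologicalType) (S : set X) :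
  continuous (set_val : S -> X).
Proof. exact: initial_continuous. Qed.

Lemma smooth_on_row_mx0 (R : realType) d e (U : set 'rV[R]_d) : open U ->
  smooth_on U (fun y => row_mx y (0 : 'rV[R]_e)).
Proof.
move=> oU; apply: smooth_on_ext (smooth_on_mulmx oU (@smooth_on_id _ _ U)
  (@smooth_on_cst _ _ U _ (row_mx 1%:M 0))) => // y _.
by rewrite mul_mx_row mulmx1 mulmx0.
Qed.

Section SliceCharts.
Variables (R : realType) (p q : nat).
Local Notation V := ('M[R]_(p, q)).
Variables (O S : set V) (d : nat).

Lemma slice_chart_is_chart (c : chart R S d) : slice_charts O S d c -> is_chart c.
Proof. by case. Qed.

(** In the ambient space the inverse of a slice chart is
    y |-> Psi (y, 0), where Psi is the inverse of the ambient chart. With the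
    next lemma this allows smoothness of maps from or to a submanifold to be
    tested after composing with the inclusion in the space of matrices. *)
Lemma smooth_slice_chart_inv (c : chart R S d) : slice_charts O S d c ->
  smooth_on (chart_image c) (set_val \o chart_inv c).
Proof.
move=> [cc [e [U [Phi [Psi [UO [oU oPU sPhi sPsi PhiK] SU domc mapc]]]]]].
have [_ oi _ _ cK] := cc.
have imP x : chart_dom c x -> row_mx (chart_map c x) 0 = Phi (set_val x).
  move=> dx; have Ux : U (set_val x) by move: dx; rewrite domc.
  have : (S `&` U) (set_val x) by split=> //; exact: set_valP.
  by rewrite SU => -[_ r0]; rewrite mapc// -r0 hsubmxK.
have imU y : chart_image c y -> (Phi @` U) (row_mx y 0).
  move=> [x dx <-]; rewrite imP//; exists (set_val x) => //.
  by move: dx; rewrite domc.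
have : smooth_on (chart_image c) (Psi \o (fun y => row_mx y 0)).
  apply: (smooth_on_comp oi oPU) => //.
  exact: smooth_on_row_mx0.
apply: smooth_on_ext => // _ [x dx <-] /=.
by rewrite imP// cK// PhiK//; move: dx; rewrite domc.
Qed.

Lemma smooth_slice_chart_map (c : chart R S d) (W : normedModType R)
    (N : set W) (g : W -> S) :
  slice_charts O S d c -> open N -> (forall y, N y -> chart_dom c (g y)) ->
  smooth_on N (set_val \o g) -> smooth_on N (chart_map c \o g).
Proof.
move=> [cc [e [U [Phi [Psi [UO [oU oPU sPhi sPsi PhiK] SU domc mapc]]]]]].
move=> oN gN sg.
have : smooth_on N (Phi \o (set_val \o g)).
  by apply: smooth_on_comp sg sPhi => // x /gN; rewrite domc.
move/(smooth_on_linear lsubmx oN); apply: smooth_on_ext => // x Nx /=.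
by rewrite mapc//; exact: gN.
Qed.

Variables (T : topologicalType) (dT : nat) (A : set (chart R T dT)).
Hypothesis A_chart : forall c, A c -> is_chart c.

Lemma smooth_at_slice (f : T -> S) (x : T) c c' N :
  A c -> slice_charts O S d c' -> open N -> N x -> N `<=` chart_dom c ->
  (forall z, N z -> chart_dom c' (f z)) ->
  smooth_on (chart_map c @` N) (set_val \o f \o chart_inv c) ->
  smooth_at A (slice_charts O S d) f x.
Proof.
move=> Ac Sc' oN Nx sN fN sf; have cc := A_chart Ac; exists c, c', N; split=> //.
  by move=> _ [z Nz <-]; exact: fN.
apply: (smooth_slice_chart_map Sc') sf.
  exact: open_chart_map_image.
have [_ _ _ _ cK] := cc.
by move=> _ [z Nz <-] /=; rewrite cK; [exact: fN|exact: sN].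
Qed.

Lemma smooth_at_slice_lift (f : T -> S) (x : T) :
  smooth_at A (slice_charts O S d) f x ->
  exists c N, [/\ A c, open N, N x, N `<=` chart_dom c &
    smooth_on (chart_map c @` N) (set_val \o f \o chart_inv c)].
Proof.
move=> [c [c' [N [[Ac Sc'] [oN Nx] sN fN sf]]]]; exists c, N; split=> //.
have [cc cc'] := (A_chart Ac, slice_chart_is_chart Sc').
have [[_ _ _ _ cK] [_ oi' _ _ cK']] := (cc, cc').
have oI : open (chart_map c @` N) by exact: open_chart_map_image.
have := smooth_on_comp oI oi' _ sf (smooth_slice_chart_inv Sc').
have fd z : N z -> chart_dom c' (f z) by move=> Nz; apply: fN; exists z.
have H y : (chart_map c @` N) y ->
    chart_image c' ((chart_map c' \o f \o chart_inv c) y).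
  move=> [z Nz <-] /=; rewrite cK; last exact: sN.
  by exists (f z) => //; exact: fd.
move=> /(_ H); apply: smooth_on_ext => // _ [z Nz <-] /=.
by rewrite cK; [rewrite cK'//; exact: fd|exact: sN].
Qed.

End SliceCharts.

(** An ambient diffeomorphism that flattens [S] gives a slice chart. The point
    [x0] of [S] is only a default value for the inverse of the chart, outside
    the image. *)
Section MakeSliceChart.
Variables (R : realType) (p q : nat).
Local Notation V := ('M[R]_(p, q)).
Variables (O S : set V) (d e : nat) (U : set V).
Variables (Phi : V -> 'rV[R]_(d + e)) (Psi : 'rV[R]_(d + e) -> V) (x0 : S).

Definition slice_chart : chart R S d :=
  Chart (set_val @^-1` U) (fun x : S => lsubmx (Phi (set_val x)))
        (fun y => insubd x0 (Psi (row_mx y 0))).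

Hypothesis (UO : U `<=` O) (dPhi : diffeo_on U Phi Psi).
Hypothesis (SU : S `&` U = [set x | U x /\ rsubmx (Phi x) = 0]).

Lemma slice_chartP : slice_charts O S d slice_chart.
Proof.
have [oU oPU sPhi sPsi PhiK] := dPhi.
have Phi0 x : S x -> U x -> row_mx (lsubmx (Phi x)) 0 = Phi x.
  move=> Sx Ux; have : (S `&` U) x by [].
  by rewrite SU => -[_ r0]; rewrite -r0 hsubmxK.
have im y : chart_image slice_chart y <-> (Phi @` U) (row_mx y 0).
  split=> [[x Ux <-] /=|[x Ux Pxy]].
    by rewrite Phi0//; [exists (set_val x)|exact: set_valP].
  have Sx : S x.
    suff [] : (S `&` U) x by [].
    by rewrite SU; split=> //; rewrite Pxy row_mxKr.
  exists (SigSub (mem_set Sx)) => //=.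
  by rewrite Pxy row_mxKl.
have cr : continuous (fun y : 'rV[R]_d => row_mx y (0 : 'rV[R]_e)).
  by move=> y; exact: (smooth_on_continuous (smooth_on_row_mx0 e openT)).
have oI : open (chart_image slice_chart).
  rewrite (_ : chart_image _ = (fun y => row_mx y 0) @^-1` (Phi @` U)).
    by apply: open_comp => // y _; exact: cr.
  by apply/seteqP; split=> y /im.
have invE y : chart_image slice_chart y ->
    set_val (chart_inv slice_chart y) = Psi (row_mx y 0).
  move=> /im [x Ux Pxy]; rewrite /= set_valE val_insubd -Pxy PhiK//.
  suff [Sx _] : (S `&` U) x by rewrite mem_set.
  by rewrite SU; split=> //; rewrite Pxy row_mxKr.
split; last by exists e, U, Phi, Psi; split.
split; [by exists U|exact: oI| | |].
- move=> x Ux; apply: (@continuous_comp _ _ _ (Phi \o set_val) lsubmx).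
    apply: continuous_comp; first exact: set_val_continuous.
    exact: smooth_on_continuous sPhi _.
  exact: linear_mx_continuous.
- move=> y iy; apply: continuous_set_val.
  have : {for y, continuous (Psi \o (fun y => row_mx y 0))}.
    apply: continuous_comp; first exact: cr.
    by apply: smooth_on_continuous sPsi _; exact/im.
  have eqPsi : \forall z \near y, (Psi \o (fun y => row_mx y 0)) z =
      (set_val \o chart_inv slice_chart) z.
    by apply: open_near_eq oI _ iy => z /invE.
  exact: near_eq_continuous eqPsi.
- move=> x Ux; apply: val_inj; rewrite -set_valE invE; last by exists x.
  by rewrite /= Phi0//; [exact: PhiK|exact: set_valP].
Qed.

End MakeSliceChart.

(** * Linear slices and the Cayley transform *)

Section KernelCoordinates.
Variable (F : fieldType).

(** By Gaussian elimination [T] is equivalent to the matrix of a projection on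
    the first [r] coordinates, whose kernel is where these vanish; the matrix
    [G] then moves these [r] coordinates to the end, where slice charts want
    them. *)
Lemma ker_coords N N' (T : 'M[F]_(N, N')) :
  exists d e (P : 'M[F]_(N, d + e)) (Q : 'M[F]_(d + e, N)),
    [/\ P *m Q = 1%:M, Q *m P = 1%:M &
        forall v : 'rV[F]_N, v *m T = 0 <-> rsubmx (v *m P) = 0].
Proof.
have := mulmx_ebase T.
have [uL uR] := (col_ebase_unit T, row_ebase_unit T).
have [rN rN'] := (rank_leq_row T, rank_leq_col T).
move: (\rank T) (col_ebase T) (row_ebase T) uL uR rN rN' => r L Z uL uR rN rN' TE.
have eN := subnKC rN; have eN' := subnKC rN'.
move: (N - r)%N (N' - r)%N eN eN' => s s' eN eN'.
subst N N'; pose G : 'M[F]_(r + s, s + r) := block_mx 0 1%:M 1%:M 0.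
pose G' : 'M[F]_(s + r, r + s) := block_mx 0 1%:M 1%:M 0.
have GG' : G *m G' = 1%:M.
  by rewrite mulmx_block !mul0mx !mulmx1 !mulmx0 !addr0 !add0r -scalar_mx_block.
have G'G : G' *m G = 1%:M.
  by rewrite mulmx_block !mul0mx !mulmx1 !mulmx0 !addr0 !add0r -scalar_mx_block.
exists s, r, (L *m G), (G' *m invmx L); split.
- by rewrite mulmxA -(mulmxA L) GG' mulmx1 mulmxV.
- by rewrite mulmxA -(mulmxA G') mulVmx// mulmx1 G'G.
move=> v; rewrite -TE !mulmxA; set w := v *m L.
have -> : rsubmx (w *m G) = lsubmx w.
  by rewrite -{1}(hsubmxK w) mul_row_block !mulmx0 !mulmx1 addr0 add0r row_mxKr.
have -> : (w *m pid_mx r *m Z = 0) <-> (w *m (pid_mx r : 'M[F]_(r + s, r + s')) = 0).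
  split=> [H|->]; last by rewrite mul0mx.
  by rewrite -(mulmxK uR (w *m _)) H mul0mx.
rewrite pid_mx_block -{1}(hsubmxK w) mul_row_block !mulmx0 mulmx1 !addr0.
by rewrite -(row_mx0 F 1 r s'); split=> [/eq_row_mx[]//|->].
Qed.

Lemma ker_mx_coords p q p' q' (L : {linear 'M[F]_(p, q) -> 'M[F]_(p', q')}) :
  exists d e (P : 'M[F]_(p * q, d + e)) (Q : 'M[F]_(d + e, p * q)),
    [/\ forall K, vec_mx (mxvec K *m P *m Q) = K,
        forall v, mxvec (vec_mx (v *m Q)) *m P = v &
        forall K, L K = 0 <-> rsubmx (mxvec K *m P) = 0].
Proof.
have [d [e [P [Q [PQ QP PT]]]]] := ker_coords (lin_mx L).
exists d, e, P, Q; split=> [K|v|K].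
- by rewrite -mulmxA PQ mulmx1 mxvecK.
- by rewrite vec_mxK -mulmxA QP mulmx1.
rewrite -PT mul_vec_lin; split=> [->|/(congr1 vec_mx)]; first exact: linear0.
by rewrite mxvecK linear0.
Qed.

End KernelCoordinates.

(** When J is invertible, K = (Y - J) (Y + J)^-1 is the Cayley transform of
    Y J^-1. It is an invertible rational change of coordinates on the open set
    of the Y such that Y + J is invertible, and it linearizes the equation
    Y^2 = J^2: indeed (Y J^-1) conjugated by J is (Y J^-1)^-1 exactly when
    Y^2 = J^2, and the Cayley transform turns inverses into opposites, so that
    the equation becomes J K = - K J. *)
Section Cayley.
Variables (F : numFieldType) (n : nat).
Implicit Types (Y J K W : 'M[F]_n).

Definition cayley J Y := (Y - J) *m invmx (Y + J).

Definition cayley_inv J K := invmx (1%:M - K) *m (1%:M + K) *m J.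

Let mx2_unit : (2%:M : 'M[F]_n) \in unitmx.
Proof. by rewrite unitmxE det_scalar unitrX// unitfE pnatr_eq0. Qed.

Lemma cayley_sub J Y : Y + J \in unitmx ->
  1%:M - cayley J Y = 2%:M *m J *m invmx (Y + J).
Proof.
move=> u; apply: (can_inj (mulmxK u)); rewrite mulmxBl mul1mx !mulmxKV//.
by rewrite opprB addrC addrA subrK mul_scalar_mx scaler_nat mulr2n.
Qed.

Lemma cayley_add J Y : Y + J \in unitmx ->
  1%:M + cayley J Y = 2%:M *m Y *m invmx (Y + J).
Proof.
move=> u; apply: (can_inj (mulmxK u)); rewrite mulmxDl mul1mx !mulmxKV//.
by rewrite addrACA subrr addr0 mul_scalar_mx scaler_nat mulr2n.
Qed.

Lemma cayley_sub_unit J Y : J \in unitmx -> Y + J \in unitmx ->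
  1%:M - cayley J Y \in unitmx.
Proof. by move=> uJ u; rewrite cayley_sub// !unitmx_mul mx2_unit uJ unitmx_inv. Qed.

Lemma cayley_add_unit J Y : Y \in unitmx -> Y + J \in unitmx ->
  1%:M + cayley J Y \in unitmx.
Proof. by move=> uJ u; rewrite cayley_add// !unitmx_mul mx2_unit uJ unitmx_inv. Qed.

(** Both sides say that [K] is the Cayley transform of [Y]. *)
Let cayley_eq J Y K :
  (1%:M - K) *m Y = (1%:M + K) *m J <-> K *m (Y + J) = Y - J.
Proof.
rewrite mulmxBl mulmxDl !mul1mx mulmxDr.
move: (K *m Y) (K *m J) => a b; split=> /eqP.
  by rewrite subr_eq => /eqP ->; rewrite addrAC [J + b - J]addrAC subrr add0r addrC.
by rewrite eq_sym subr_eq => /eqP ->; rewrite addrAC [a + b - a]addrAC subrr add0r addrC.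
Qed.

Lemma cayleyK J Y : J \in unitmx -> Y + J \in unitmx ->
  cayley_inv J (cayley J Y) = Y.
Proof.
move=> uJ u; have uK := cayley_sub_unit uJ u.
rewrite /cayley_inv -mulmxA; apply: (can_inj (mulKmx uK)); rewrite mulKVmx//.
by apply/esym/cayley_eq; rewrite mulmxKV.
Qed.

Lemma cayley_inv_add J K : 1%:M - K \in unitmx ->
  cayley_inv J K + J = 2%:M *m invmx (1%:M - K) *m J.
Proof.
move=> u; rewrite /cayley_inv -{2}(mul1mx J) -mulmxDl; congr (_ *m _).
apply: (can_inj (mulKmx u)); rewrite mulmxDr mulKVmx// mulmx1.
rewrite mul_scalar_mx -scalemxAr mulmxV// scaler_nat mulr2n.
by rewrite addrACA subrr addr0.
Qed.

Lemma cayley_inv_add_unit J K : J \in unitmx -> 1%:M - K \in unitmx ->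
  cayley_inv J K + J \in unitmx.
Proof.
by move=> uJ u; rewrite cayley_inv_add// !unitmx_mul mx2_unit uJ unitmx_inv u.
Qed.

Lemma cayley_inv_unit J K : J \in unitmx -> 1%:M - K \in unitmx ->
  (cayley_inv J K \in unitmx) = (1%:M + K \in unitmx).
Proof. by move=> uJ u; rewrite /cayley_inv !unitmx_mul uJ unitmx_inv u andbT. Qed.

Lemma cayley_invK J K : J \in unitmx -> 1%:M - K \in unitmx ->
  cayley J (cayley_inv J K) = K.
Proof.
move=> uJ u; have uY := cayley_inv_add_unit uJ u.
apply: (can_inj (mulmxK uY)); rewrite /cayley mulmxKV//.
by apply/esym/cayley_eq; rewrite /cayley_inv -mulmxA mulKVmx.
Qed.

Lemma sqr_cayley_anticomm J Y : Y + J \in unitmx -> Y *m Y = J *m J ->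
  J *m cayley J Y + cayley J Y *m J = 0.
Proof.
move=> u YJ; have KE : cayley J Y *m (Y + J) = Y - J by rewrite mulmxKV.
move: (cayley J Y) KE => K KE.
apply: (can_inj (mulmxK u)); rewrite mul0mx mulmxDl -!mulmxA KE.
have -> : J *m (Y + J) = (Y + J) *m Y by rewrite mulmxDr mulmxDl YJ addrC.
by rewrite mulmxA KE mulmxBl mulmxBr YJ addrA subrK subrr.
Qed.

(** If J K = - K J then (1 + K) J = J (1 - K), so the inverse Cayley transform
    of [K] is a conjugate of [J]; in particular its square is conjugate to that
    of [J] by [1 - K]. *)
Lemma anticomm_cayley_inv J K : 1%:M - K \in unitmx ->
  J *m K + K *m J = 0 ->
  cayley_inv J K = invmx (1%:M - K) *m J *m (1%:M - K).
Proof.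
move=> u /eqP; rewrite addr_eq0 => /eqP JK.
rewrite /cayley_inv -!mulmxA mulmxDl mulmxBr mul1mx mulmx1 JK opprK.
by [].
Qed.

(** Two square roots of the same matrix are conjugate under their sum as soon
    as it is invertible. This explicit conjugating matrix depends smoothly on
    [Y]: it provides the local sections of the orbit map, and shows that
    square roots that are close to each other have the same spectrum. *)
Lemma sqr_conj_add J Y : Y *m Y = J *m J -> Y *m (Y + J) = (Y + J) *m J.
Proof. by move=> YJ; rewrite mulmxDr mulmxDl YJ addrC. Qed.

End Cayley.

(** * Orbits of square roots as embedded submanifolds *)

Section Conjugation.
Variables (R : realType) (n : nat).
Implicit Types (C X Y Z : 'M[R]_n).

Lemma Gamma_hat_mul C X Y : C \in unitmx ->
  Gamma_hat C X *m Gamma_hat C Y = Gamma_hat C (X *m Y).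
Proof. by move=> uC; rewrite /Gamma_hat -!mulmxA mulKmx. Qed.

Lemma Gamma_hat_comp C X Y : C \in unitmx -> X \in unitmx ->
  Gamma_hat C (Gamma_hat X Y) = Gamma_hat (C *m X) Y.
Proof.
move=> uC uX; rewrite /Gamma_hat -!mulmxA; do 3!congr (_ *m _).
have uCX : C *m X \in unitmx by rewrite unitmx_mul uC.
by apply: (can_inj (mulmxK uCX)); rewrite mulVmx// -!mulmxA mulKmx// mulVmx.
Qed.

Lemma Gamma_hat_eq C X Y : C \in unitmx ->
  C *m X = Y *m C -> Gamma_hat C X = Y.
Proof. by move=> uC; rewrite /Gamma_hat => ->; rewrite mulmxK. Qed.

Lemma Gamma_hat_def C X : C \in unitmx -> C *m X = Gamma_hat C X *m C.
Proof. by move=> uC; rewrite /Gamma_hat mulmxKV. Qed.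

Lemma Gamma_hat_cancel C : C \in unitmx ->
  cancel (@Gamma_hat R n C) (Gamma_hat (invmx C)).
Proof.
move=> uC X; rewrite Gamma_hat_comp ?unitmx_inv// mulVmx//.
by rewrite /Gamma_hat mul1mx invmx1 mulmx1.
Qed.

Lemma Gamma_hat_cancelV C : C \in unitmx ->
  cancel (Gamma_hat (invmx C)) (@Gamma_hat R n C).
Proof.
by move=> uC X; rewrite -{1}(invmxK C) Gamma_hat_cancel ?unitmx_inv.
Qed.

Lemma Gamma_hat_unit C X : C \in unitmx ->
  (Gamma_hat C X \in unitmx) = (X \in unitmx).
Proof. by move=> uC; rewrite /Gamma_hat !unitmx_mul unitmx_inv uC andbT. Qed.

Lemma Gamma_hat_id C X : centralizer X C -> Gamma_hat C X = X.
Proof. by move=> [uC cC]; apply: Gamma_hat_eq. Qed.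

Lemma Gamma_hat_centralizer C X Y : C \in unitmx -> centralizer Y X ->
  Gamma_hat (C *m X) Y = Gamma_hat C Y.
Proof.
by move=> uC cX; rewrite -Gamma_hat_comp ?(Gamma_hat_id cX)//; case: cX.
Qed.

Lemma Gamma_hat_eqP X Y J : X \in unitmx -> Y \in unitmx ->
  Gamma_hat X J = Gamma_hat Y J <-> centralizer J (invmx X *m Y).
Proof.
move=> uX uY; have uXY : invmx X *m Y \in unitmx by rewrite unitmx_mul unitmx_inv uX.
split=> [XY|cXY]; last first.
  by rewrite -[Y in RHS](mulKVmx uX) Gamma_hat_centralizer.
split; first exact: uXY.
have {1}-> : J = Gamma_hat (invmx X *m Y) J.
  by rewrite -Gamma_hat_comp ?unitmx_inv// -XY Gamma_hat_cancel.
by rewrite -Gamma_hat_def.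
Qed.

Lemma smooth_on_Gamma_hat (V : normedModType R) (U : set V) C (f : V -> 'M[R]_n) :
  open U -> smooth_on U f -> smooth_on U (fun x => Gamma_hat C (f x)).
Proof.
move=> oU sf; apply: smooth_on_mulmx => //; last exact: smooth_on_cst.
by apply: smooth_on_mulmx => //; exact: smooth_on_cst.
Qed.

Lemma smooth_on_Gamma_hatl (V : normedModType R) (U : set V) X (f : V -> 'M[R]_n) :
  open U -> (forall x, U x -> f x \in unitmx) -> smooth_on U f ->
  smooth_on U (fun x => Gamma_hat (f x) X).
Proof.
move=> oU uf sf; apply: smooth_on_mulmx => //; last exact: smooth_on_invmx.
by apply: smooth_on_mulmx => //; exact: smooth_on_cst.
Qed.

End Conjugation.

Section CommutantManifold.
Variables (R : realType) (n : nat) (A : 'M[R]_n).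

Lemma open_GL : open (GL R n).
Proof. exact: open_unitmx. Qed.

Definition centralizer_1 : centralizer A := SigSub (mem_set (centralizer1 A)).

(** The centralizer is the trace on the open set of invertible matrices of a
    linear subspace, so linear coordinates in which this subspace is a
    coordinate one form a global slice chart. *)
Lemma centralizer_chart : exists dG (c : chart R (centralizer A) dG),
  slice_charts (GL R n) (centralizer A) dG c /\ chart_dom c = setT.
Proof.
pose L := (mulmx A - mulmxr A)%R : {linear 'M[R]_n -> 'M[R]_n}.
have [d [e [P [Q [PQ QP PL]]]]] := ker_mx_coords L.
exists d, (slice_chart (GL R n) (fun X => mxvec X *m P)
  (fun v => vec_mx (v *m Q)) centralizer_1); split; last first.
  by apply/seteqP; split=> // X _; exact: centralizer_unit.
have sQ : smooth_on setT (fun v : 'rV_(d + e) => vec_mx (v *m Q) : 'M[R]_n).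
  apply: (smooth_on_linear vec_mx openT).
  by apply: smooth_on_mulmx; [exact: openT|exact: smooth_on_id|exact: smooth_on_cst].
have imE : (fun X : 'M[R]_n => mxvec X *m P) @` GL R n
    = [set v | vec_mx (v *m Q) \in unitmx].
  apply/seteqP; split=> [_ [X uX <-] /=|v uv]; first by rewrite PQ.
  by exists (vec_mx (v *m Q)).
apply: slice_chartP => //.
  split=> [||||X _]; rewrite ?imE; last exact: PQ.
  - exact: open_GL.
  - exact: open_preimage_unitmx.
  - apply: smooth_on_mulmx; [exact: open_GL| |exact: smooth_on_cst].
    by apply: (smooth_on_linear mxvec open_GL); exact: smooth_on_id.
  - exact: smooth_on_subset sQ.
apply/seteqP; split=> [X [[uX cX] _]|X [uX /PL/eqP]] /=.
  by split=> //; apply/PL => /=; rewrite cX subrr.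
by rewrite /= subr_eq0 => /eqP.
Qed.

End CommutantManifold.

Section Orbit.
Variables (R : realType) (n : nat) (J C : 'M[R]_n).
Hypotheses (uJ : J \in unitmx) (uC : C \in unitmx).
Local Notation A := (J *m J).
Implicit Types (X Y Z W : 'M[R]_n).

(** The square roots C X J X^-1 C^-1, with [X] in the centralizer of J^2, of the
    matrix C J^2 C^-1. *)
Definition orbit := [set Gamma_hat (C *m X) J | X in centralizer A].

(** The domain of the chart centred at Z J Z^-1: there, the Cayley transform
    with respect to [J] of Z^-1 Y Z makes sense. *)
Definition orbit_dom Z : set 'M[R]_n :=
  [set Y | Y \in unitmx /\ Gamma_hat (invmx Z) Y + J \in unitmx].

(** A smooth choice, near C X J X^-1 C^-1, of a matrix of the centralizer of J^2
    that sends [J] to [Y]; it is built with the sum of [J] and of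
    (C X)^-1 Y (C X), see [sqr_conj_add]. *)
Definition orbit_section X Y := X *m (Gamma_hat (invmx (C *m X)) Y + J).

Lemma mul_centralizer_unit X : centralizer A X -> C *m X \in unitmx.
Proof. by move=> [uX _]; rewrite unitmx_mul uC. Qed.

Lemma orbit_sqr Y : orbit Y -> Y *m Y = Gamma_hat C A.
Proof.
move=> [X cX <-]; rewrite Gamma_hat_mul ?mul_centralizer_unit//.
exact: Gamma_hat_centralizer.
Qed.

Lemma orbit_unit Y : orbit Y -> Y \in unitmx.
Proof. by move=> [X cX <-]; rewrite Gamma_hat_unit ?mul_centralizer_unit. Qed.

Lemma orbit_sectionP X Y : centralizer A X -> orbit_dom (C *m X) Y ->
  Y *m Y = Gamma_hat C A ->
  centralizer A (orbit_section X Y) /\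
  Gamma_hat (C *m orbit_section X Y) J = Y.
Proof.
move=> cX [uY uYJ] YY; have uCX := mul_centralizer_unit cX.
set Y' := Gamma_hat _ Y in uYJ; have Y'Y' : Y' *m Y' = A.
  rewrite Gamma_hat_mul ?unitmx_inv// YY.
  by rewrite -(Gamma_hat_centralizer uC cX) Gamma_hat_cancel.
have cW : centralizer A (Y' + J).
  split=> //; rewrite mulmxDl mulmxDr; congr (_ + _).
    by rewrite -Y'Y' mulmxA.
  by rewrite mulmxA.
split; first exact: centralizerM.
rewrite /orbit_section mulmxA -Gamma_hat_comp//.
rewrite (_ : Gamma_hat (Y' + J) J = Y'); first exact: Gamma_hat_cancelV.
by apply: Gamma_hat_eq => //; rewrite sqr_conj_add.
Qed.

Lemma orbit_dom_center X : centralizer A X ->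
  orbit_dom (C *m X) (Gamma_hat (C *m X) J).
Proof.
move=> cX; have uCX := mul_centralizer_unit cX; split; first by rewrite Gamma_hat_unit.
rewrite Gamma_hat_cancel// -mulr2n -scaler_nat unitmxZ// unitfE.
by rewrite pnatr_eq0.
Qed.

Lemma open_orbit_dom Z : open (orbit_dom Z).
Proof.
apply: openI; first exact: open_GL.
apply: open_preimage_unitmx; apply: smooth_onD; first exact: openT.
  by apply: smooth_on_Gamma_hat; [exact: openT|exact: smooth_on_id].
exact: smooth_on_cst.
Qed.

Lemma smooth_on_orbit_section X :
  smooth_on (orbit_dom (C *m X)) (orbit_section X).
Proof.
have oU := @open_orbit_dom (C *m X).
apply: smooth_on_mulmx => //; first exact: smooth_on_cst.
apply: smooth_onD => //; last exact: smooth_on_cst.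
by apply: smooth_on_Gamma_hat => //; exact: smooth_on_id.
Qed.

(** The chart centred at Z J Z^-1, with Z = C X, is Y |-> K, the Cayley transform
    with respect to [J] of Z^-1 Y Z, followed by linear coordinates in which the
    subspace J K + K J = 0 is a coordinate one. In this chart the orbit is that
    subspace: any square root of C J^2 C^-1 in the domain is in the orbit, by
    [orbit_sectionP]. All the charts are conjugates of the one at [J], whence a
    dimension [d] that is the same for all of them. *)
Lemma orbit_chart : exists d, forall X (x0 : orbit), centralizer A X ->
  exists2 c, slice_charts (GL R n) orbit d c &
    chart_dom c = set_val @^-1` orbit_dom (C *m X).
Proof.
pose L := (mulmx J + mulmxr J)%R : {linear 'M[R]_n -> 'M[R]_n}.
have [d [e [P [Q [PQ QP PL]]]]] := ker_mx_coords L.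
exists d => X x0 cX; set Z := C *m X; have uZ : Z \in unitmx := mul_centralizer_unit cX.
have uZV : invmx Z \in unitmx by rewrite unitmx_inv.
pose Phi Y := mxvec (cayley J (Gamma_hat (invmx Z) Y)) *m P.
pose Psi v := Gamma_hat Z (cayley_inv J (vec_mx (v *m Q))).
exists (slice_chart (orbit_dom Z) Phi Psi x0); last by [].
have oU := @open_orbit_dom Z.
have imE : Phi @` orbit_dom Z = [set v | 1%:M - vec_mx (v *m Q) \in unitmx] `&`
    [set v | 1%:M + vec_mx (v *m Q) \in unitmx].
  apply/seteqP; split=> [_ [Y [uY uYJ] <-] /=|v [/= uv uv']].
    rewrite /Phi PQ; split; first exact: cayley_sub_unit.
    by apply: cayley_add_unit => //; rewrite Gamma_hat_unit.
  exists (Psi v); last by rewrite /Phi /Psi Gamma_hat_cancel// cayley_invK// QP.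
  split; first by rewrite Gamma_hat_unit// cayley_inv_unit.
  by rewrite Gamma_hat_cancel//; exact: cayley_inv_add_unit.
have sQ : smooth_on setT (fun v : 'rV_(d + e) => vec_mx (v *m Q) : 'M[R]_n).
  apply: (smooth_on_linear vec_mx openT).
  by apply: smooth_on_mulmx; [exact: openT|exact: smooth_on_id|exact: smooth_on_cst].
have s1 : smooth_on setT (fun v : 'rV_(d + e) => 1%:M - vec_mx (v *m Q) : 'M[R]_n).
  apply: smooth_onD; [exact: openT|exact: smooth_on_cst|].
  by apply: smooth_onN => //; exact: openT.
have s2 : smooth_on setT (fun v : 'rV_(d + e) => 1%:M + vec_mx (v *m Q) : 'M[R]_n).
  by apply: smooth_onD => //; [exact: openT|exact: smooth_on_cst].
have oI : open (Phi @` orbit_dom Z).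
  by rewrite imE; apply: openI; exact: open_preimage_unitmx.
apply: slice_chartP => [Y []//||].
  split=> [|//|||Y [uY uYJ]]; first exact: oU; last first.
  - by rewrite /Psi /Phi PQ cayleyK// Gamma_hat_cancelV.
  - apply: (smooth_on_Gamma_hat _ oI).
    apply: (smooth_on_mulmx oI); last exact: smooth_on_cst.
    apply: (smooth_on_mulmx oI); last exact: smooth_on_subset s2.
    apply: (smooth_on_invmx oI); last exact: smooth_on_subset s1.
    by rewrite imE => v [].
  - apply: smooth_on_mulmx => //; last exact: smooth_on_cst.
    apply: (smooth_on_linear mxvec oU).
    have sG : smooth_on (orbit_dom Z) (Gamma_hat (invmx Z)).
      by apply: smooth_on_Gamma_hat => //; exact: smooth_on_id.
    apply: smooth_on_mulmx => //.
      by apply: smooth_onD => //; exact: smooth_on_cst.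
    apply: smooth_on_invmx => //; first by move=> Y [].
    by apply: smooth_onD => //; exact: smooth_on_cst.
apply/seteqP; split=> Y [].
  move=> oY [uY uYJ]; split=> //; apply/PL; rewrite /= sqr_cayley_anticomm//.
  rewrite Gamma_hat_mul// orbit_sqr//.
  by rewrite -(Gamma_hat_centralizer uC cX) Gamma_hat_cancel.
move=> [uY uYJ] /PL /= anti; split=> //.
have := anticomm_cayley_inv (cayley_sub_unit uJ uYJ) anti.
rewrite cayleyK// => YE.
have YY : Y *m Y = Gamma_hat C A.
  set K := cayley _ _ in anti YE.
  have uK : 1%:M - K \in unitmx by exact: cayley_sub_unit.
  have {}YE : Gamma_hat (invmx Z) Y = Gamma_hat (invmx (1%:M - K)) J.
    by rewrite YE /Gamma_hat invmxK.
  rewrite -[Y](Gamma_hat_cancelV uZ) YE !Gamma_hat_mul ?unitmx_inv//.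
  rewrite -(Gamma_hat_centralizer uC cX); congr Gamma_hat.
  apply: Gamma_hat_id; apply: centralizerV; split=> //.
  (* 1 - K commutes with J^2 because K anticommutes with J *)
  have KJ : J *m K = - (K *m J) by apply/eqP; rewrite -addr_eq0 anti.
  rewrite mulmxBl mulmxBr mulmx1 mul1mx; congr (_ - _).
  by rewrite -mulmxA KJ mulmxN mulmxA KJ mulNmx opprK mulmxA.
have [cS <-] := orbit_sectionP cX (conj uY uYJ) YY.
by exists (orbit_section X Y).
Qed.

End Orbit.

(** * Countability and separation for subspaces of matrices *)

Section Countability.

Lemma second_countable_embedding (X T : topologicalType) (f : T -> X) :
  continuous f -> (forall U, open U -> exists2 V, open V & U = f @^-1` V) ->
  @second_countable X -> @second_countable T.
Proof.
move=> cf fo [B cB [oB bB]]; exists [set f @^-1` b | b in B].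
  exact: sub_countable (card_image_le _ _) cB.
split=> [_ [b /oB ob <-]|x U]; first by apply: open_comp => // y _; exact: cf.
rewrite nbhsE => -[W [oW Wx] WU]; have [V oV WV] := fo _ oW.
have Vfx : nbhs (f x) V by apply: open_nbhs_nbhs; split=> //; rewrite WV in Wx.
have [b [Bb bx] bV] := bB (f x) V Vfx.
exists (f @^-1` b); first by split=> //; exists b.
by apply: subset_trans WU; rewrite WV; exact: preimage_subset.
Qed.

Lemma hausdorff_injective (X T : topologicalType) (f : T -> X) :
  continuous f -> injective f -> hausdorff_space X -> hausdorff_space T.
Proof.
move=> cf injf; rewrite !open_hausdorff => hX x y xy.
have fxy : f x != f y by apply: contra xy => /eqP/injf/eqP.
have [[A B] /= [Afx Bfy] [oA oB AB]] := hX _ _ fxy.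
exists (f @^-1` A, f @^-1` B); first by split; rewrite inE/=; exact/set_mem.
split=> /=; try by apply: open_comp => // z _; exact: cf.
by apply/eqP; rewrite -preimage_setI (eqP AB) preimage_set0.
Qed.

(** The balls of radius 1/(k+1) around the rational matrices form a basis. *)
Lemma second_countable_mx (R : realType) p q : @second_countable 'M[R]_(p, q).
Proof.
pose B (Ak : 'M[rat]_(p, q) * nat) :=
  ball (map_mx ratr Ak.1 : 'M[R]_(p, q)) (Ak.2.+1%:R^-1).
exists (range B); first exact: sub_countable (card_image_le _ _) (countableP _).
split=> [_ [Ak _ <-]|A U]; first exact: ball_open.
move=> /nbhs_ballP[e /= e0 eU].
have [k ke] : exists k : nat, k.+1%:R^-1 < e / 2.
  have e20 : 0 < e / 2 by rewrite divr_gt0.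
  have := near_infty_natSinv_lt (PosNum e20) => -[k _ /(_ k)] /= H.
  by exists k; exact: H.
have rat_near i j : {r : rat | `|A i j - ratr r| < k.+1%:R^-1 :> R}.
  apply: cid; have /rat_in_itvoo[r] : A i j - k.+1%:R^-1 < A i j + k.+1%:R^-1 :> R.
    by rewrite ltrBlDr -addrA ltrDl addr_gt0 ?invr_gt0.
  rewrite in_itv/= => rA; exists r.
  by rewrite distrC ltr_distl.
pose A' := \matrix_(i, j) sval (rat_near i j).
have AA' : ball (map_mx ratr A' : 'M[R]_(p, q)) (k.+1%:R^-1) A.
  split=> [|i j]; first by rewrite invr_gt0.
  by rewrite !mxE; apply: ball_sym; exact: (svalP (rat_near i j)).
exists (B (A', k)); first by split=> //; exists (A', k).
move=> M A'M; apply: eU; apply: le_ball (ball_triangle (ball_sym AA') A'M).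
by rewrite [leRHS]splitr lerD// ltW.
Qed.

End Countability.

(** * The coset space and its bijection with the orbit *)

Section HomogeneousSpace.
Variables (R : realType) (n : nat) (J C : 'M[R]_n).
Hypotheses (uJ : J \in unitmx) (uC : C \in unitmx).
Local Notation A := (J *m J).
Local Notation G := (centralizer A).
Local Notation H := (homogeneous_space A J).
Local Notation S := (orbit J C).
Local Notation proj := (@coset_proj R n A J).

Lemma orbit_mapP (X : G) : S (Gamma_hat (C *m set_val X) J).
Proof. by exists (set_val X) => //; exact: set_valP. Qed.

Definition orbit_map (X : G) : S := SigSub (mem_set (orbit_mapP X)).

Definition coset_orbit : H -> S := orbit_map \o repr.

Lemma proj_eq (X Y : G) : proj X = proj Y <->
  centralizer J (invmx (set_val X) *m set_val Y).
Proof.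
split=> [/eqmodP/asboolP//|XY]; apply/eqmodP; exact/asboolP.
Qed.

(** The stabilizer of [J] under conjugation is the centralizer of [J], hence
    the fibres of the orbit map are the cosets. *)
Lemma orbit_map_eq (X Y : G) : orbit_map X = orbit_map Y <-> proj X = proj Y.
Proof.
rewrite proj_eq; have [uX uY] := (centralizer_unit X, centralizer_unit Y).
have E : orbit_map X = orbit_map Y <->
    Gamma_hat (set_val X) J = Gamma_hat (set_val Y) J.
  split=> [/(congr1 set_val)|XY].
    rewrite !set_valE /= -!Gamma_hat_comp//.
    exact: (can_inj (Gamma_hat_cancel uC)).
  by apply: val_inj; rewrite /= -!Gamma_hat_comp// XY.
by rewrite E Gamma_hat_eqP.
Qed.

Lemma coset_orbit_proj (X : G) : coset_orbit (proj X) = orbit_map X.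
Proof. by apply/orbit_map_eq; exact: reprK. Qed.

Lemma coset_orbit_inj : injective coset_orbit.
Proof.
by move=> y z; rewrite -[y]reprK -[z]reprK !coset_orbit_proj => /orbit_map_eq.
Qed.

Lemma coset_of_orbit_subproof (Y : S) : exists X : G, orbit_map X = Y.
Proof.
have [X cX XY] := set_valP Y; exists (SigSub (mem_set cX)).
by apply: val_inj; rewrite /= -XY.
Qed.

Definition orbit_coset (Y : S) : H := proj (sval (cid (coset_of_orbit_subproof Y))).

Lemma orbit_cosetK : cancel orbit_coset coset_orbit.
Proof.
by move=> Y; rewrite coset_orbit_proj; exact: (svalP (cid (coset_of_orbit_subproof Y))).
Qed.

Lemma coset_orbitK : cancel coset_orbit orbit_coset.
Proof. by move=> y; apply: coset_orbit_inj; rewrite orbit_cosetK. Qed.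

Lemma orbit_coset_map (X : G) : orbit_coset (orbit_map X) = proj X.
Proof. by apply: coset_orbit_inj; rewrite orbit_cosetK coset_orbit_proj. Qed.

Lemma smooth_on_conj_orbit (V : normedModType R) (U : set V) (f : V -> 'M[R]_n) :
  open U -> (forall x, U x -> f x \in unitmx) -> smooth_on U f ->
  smooth_on U (fun x => Gamma_hat (C *m f x) J).
Proof.
move=> oU uf sf; apply: (smooth_on_Gamma_hatl _ oU).
  by move=> x /uf ufx; rewrite unitmx_mul uC.
by apply: (smooth_on_mulmx oU) => //; exact: smooth_on_cst.
Qed.

Lemma orbit_map_continuous : continuous orbit_map.
Proof.
move=> X; apply: continuous_set_val.
apply: (@continuous_comp _ _ _ set_val (fun X => Gamma_hat (C *m X) J)).
  exact: set_val_continuous.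
apply: (@smooth_on_continuous _ _ _ (GL R n)); last exact: centralizer_unit.
apply: smooth_on_conj_orbit; [exact: open_GL|by []|exact: smooth_on_id].
Qed.

Lemma coset_orbit_continuous : continuous coset_orbit.
Proof.
apply/quotient_continuous => X.
rewrite (_ : _ \o _ = orbit_map); first exact: orbit_map_continuous.
by apply/funext => Y /=; exact: coset_orbit_proj.
Qed.

(** Outside [section_dom X] this takes the default value [X]. *)
Definition local_section (X : G) (Y : S) : G :=
  insubd X (orbit_section J C (set_val X) (set_val Y)).

Definition section_dom (X : G) : set S :=
  set_val @^-1` orbit_dom J (C *m set_val X).

Lemma local_sectionE (X : G) (Y : S) : section_dom X Y ->
  set_val (local_section X Y) = orbit_section J C (set_val X) (set_val Y).
Proof.
move=> dY; rewrite set_valE val_insubd ifT//; apply: mem_set.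
by have [] := orbit_sectionP uC (set_valP X) dY (orbit_sqr uC (set_valP Y)).
Qed.

Lemma local_sectionK (X : G) (Y : S) : section_dom X Y ->
  orbit_map (local_section X Y) = Y.
Proof.
move=> dY; apply: val_inj; rewrite /= local_sectionE//.
by have [] := orbit_sectionP uC (set_valP X) dY (orbit_sqr uC (set_valP Y)).
Qed.

Lemma open_section_dom (X : G) : open (section_dom X).
Proof.
apply: open_comp; last exact: open_orbit_dom.
by move=> Y _; exact: set_val_continuous.
Qed.

Lemma section_dom_center (X : G) : section_dom X (orbit_map X).
Proof. by apply: orbit_dom_center => //; exact: set_valP. Qed.

Lemma local_section_continuous (X : G) (Y : S) : section_dom X Y ->
  {for Y, continuous (local_section X)}.
Proof.
move=> dY; apply: continuous_set_val.
have E : \forall Z \near Y, (orbit_section J C (set_val X) \o set_val) Z =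
    (set_val \o local_section X) Z.
  have nY := open_nbhs_nbhs (conj (@open_section_dom X) dY).
  by apply: filterS nY => Z dZ /=; rewrite local_sectionE.
apply: near_eq_continuous E _; apply: continuous_comp.
  exact: set_val_continuous.
exact: (smooth_on_continuous (@smooth_on_orbit_section _ _ J C (set_val X)) dY).
Qed.

Lemma orbit_coset_local (X : G) (Y : S) : section_dom X Y ->
  orbit_coset Y = proj (local_section X Y).
Proof. by move=> dY; rewrite -{1}(local_sectionK dY) orbit_coset_map. Qed.

(** Near each point, the inverse bijection is the projection composed with a
    continuous local section of the orbit map. *)
Lemma orbit_coset_continuous : continuous orbit_coset.
Proof.
move=> Y; have [X XY] := coset_of_orbit_subproof Y.
have dY : section_dom X Y by rewrite -XY; exact: section_dom_center.
have E : \forall Z \near Y, (proj \o local_section X) Z = orbit_coset Z.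
  have nY := open_nbhs_nbhs (conj (@open_section_dom X) dY).
  by apply: filterS nY => Z dZ /=; rewrite (orbit_coset_local dZ).
apply: near_eq_continuous E _; apply: continuous_comp.
  exact: local_section_continuous.
exact: pi_continuous.
Qed.

End HomogeneousSpace.

Arguments section_dom {R n J} C X _.
Arguments local_section {R n J} C X Y.

(** * The smooth structure of the coset space *)

Lemma open_setI_preimage (T T' : topologicalType) (f : T -> T') (D : set T)
    (N : set T') :
  open D -> open N -> (forall x, D x -> {for x, continuous f}) ->
  open (D `&` f @^-1` N).
Proof.
move=> oD oN cf; rewrite openE => x [Dx Nfx]; apply: filterI.
  exact: open_nbhs_nbhs.
by apply: (cf x Dx); exact: open_nbhs_nbhs.
Qed.

(** Charts carried from [S] to [T] by a homeomorphism. *)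
Section TransportedCharts.
Variables (R : realType) (T S : topologicalType) (d : nat).
Variables (f : T -> S) (g : S -> T).
Hypotheses (cf : continuous f) (cg : continuous g).
Hypotheses (fK : cancel f g) (gK : cancel g f).

Definition transport_chart (c : chart R S d) : chart R T d :=
  Chart (f @^-1` chart_dom c) (chart_map c \o f) (g \o chart_inv c).

Lemma transport_image (c : chart R S d) (N : set S) :
  chart_map (transport_chart c) @` (f @^-1` N) = chart_map c @` N.
Proof.
apply/seteqP; split=> [_ [x Nx <-]|_ [y Ny <-]]; first by exists (f x).
by exists (g y) => /=; rewrite gK.
Qed.

Lemma transport_is_chart (c : chart R S d) :
  is_chart c -> is_chart (transport_chart c).
Proof.
have imE : chart_image (transport_chart c) = chart_image c.
  exact: transport_image.
move=> [od oi cm ci cK]; split; rewrite ?imE.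
- by apply: open_comp od => x _; exact: cf.
- exact: oi.
- by move=> x dx; apply: continuous_comp; [exact: cf|exact: cm].
- by move=> y iy; apply: continuous_comp; [exact: ci|exact: cg].
- by move=> x dx; rewrite /= cK.
Qed.

End TransportedCharts.

Section HomogeneousStructure.
Variables (R : realType) (n : nat) (J C : 'M[R]_n).
Hypotheses (uJ : J \in unitmx) (uC : C \in unitmx).
Local Notation A := (J *m J).
Local Notation G := (centralizer A).
Local Notation H := (homogeneous_space A J).
Local Notation S := (orbit J C).
Local Notation proj := (@coset_proj R n A J).
Local Notation F := (@coset_orbit R n J C).
Local Notation F' := (@orbit_coset R n J C).

Variable d : nat.
Hypothesis orbit_charts : forall X : G,
  exists2 c, slice_charts (GL R n) S d c & chart_dom c = section_dom C X.

Variable dG : nat.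
Variable cG : chart R G dG.
Hypotheses (cGP : slice_charts (GL R n) G dG cG) (cGT : chart_dom cG = setT).

Lemma smooth_on_set_val_section (c : chart R S d) (X : G) (N : set S) :
  slice_charts (GL R n) S d c -> open N -> N `<=` chart_dom c ->
  N `<=` section_dom C X ->
  smooth_on (chart_map c @` N)
    (set_val \o (local_section C X) \o chart_inv c).
Proof.
move=> Sc oN Nc NX; have cc := slice_chart_is_chart Sc.
have oI := open_chart_map_image cc oN Nc; have [_ _ _ _ cK] := cc.
have : smooth_on (chart_map c @` N)
    (orbit_section J C (set_val X) \o (set_val \o chart_inv c)).
  apply: (smooth_on_comp oI (@open_orbit_dom _ _ J (C *m set_val X))).
  - by move=> _ [Y NY <-] /=; rewrite cK; [exact: NX|exact: Nc].
  - apply: smooth_on_subset (smooth_slice_chart_inv Sc).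
    by move=> _ [Y NY <-]; exists Y => //; exact: Nc.
  - exact: smooth_on_orbit_section.
apply: (smooth_on_ext oI) => _ [Y NY <-] /=.
rewrite cK; last exact: Nc.
by rewrite local_sectionE//; exact: NX.
Qed.

(** Locally the bijection is the orbit map, a rational function on the
    centralizer, composed with a smooth local section of the projection. *)
Lemma smooth_coset_orbit e (K : set (chart R H e)) :
  homogeneous_structure dG K -> smooth_map K (slice_charts (GL R n) S d) F.
Proof.
move=> [[_ _ [Kc _ _]] _ secs] y; have [N [s [oN Ny ss sK]]] := secs y.
have [c [N1 [Kc1 oN1 N1y N1c ss1]]] := smooth_at_slice_lift Kc (ss y Ny).
have [c' Sc' dc'] := orbit_charts (repr y).
have oN2 : open (N `&` N1 `&` F @^-1` chart_dom c').
  apply: open_setI_preimage; [exact: openI| |].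
    by rewrite dc'; exact: open_section_dom.
  by move=> z _; exact: coset_orbit_continuous.
have N2c : N `&` N1 `&` F @^-1` chart_dom c' `<=` chart_dom c.
  by move=> z [[_ /N1c]].
have cc := Kc _ Kc1; have oI := open_chart_map_image cc oN2 N2c.
have [_ _ _ _ cK] := cc.
apply: (smooth_at_slice Kc Kc1 Sc' oN2) => [||z []//|]; last 1 first.
- have : smooth_on (chart_map c @` (N `&` N1 `&` F @^-1` chart_dom c'))
    (fun v => Gamma_hat (C *m (set_val \o s \o chart_inv c) v) J).
    apply: smooth_on_conj_orbit => //; first by move=> v _; exact: centralizer_unit.
    apply: smooth_on_subset ss1.
    by move=> _ [z [[_ N1z] _] <-]; exists z.
  apply: (smooth_on_ext oI) => _ [z Nz <-] /=; rewrite cK; last exact: N2c.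
  have [[/sK projsz _] _] := Nz.
  by rewrite -[in RHS]projsz coset_orbit_proj.
- split; first by split.
  by rewrite /= dc'; exact: section_dom_center.
- exact: N2c.
Qed.

(** Locally the inverse bijection is the projection, smooth for the structure
    [K], composed with the explicit smooth local section of the orbit map. *)
Lemma smooth_orbit_coset e (K : set (chart R H e)) :
  homogeneous_structure dG K -> smooth_map (slice_charts (GL R n) S d) K F'.
Proof.
move=> [_ sproj _] Y; have [X XY] := coset_of_orbit_subproof Y.
have dY : section_dom C X Y by rewrite -XY; exact: section_dom_center.
have [c [c' [N [[Gc Kc'] [oN NY] Nc Nc' sN]]]] := sproj (local_section C X Y).
have [c0 Sc0 dc0] := orbit_charts X.
pose N' := section_dom C X `&` local_section C X @^-1` N.
have oN' : open N'.
  apply: open_setI_preimage; [exact: open_section_dom|exact: oN|].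
  exact: local_section_continuous.
have N'c0 : N' `<=` chart_dom c0 by rewrite dc0 => Z [].
have cc0 := slice_chart_is_chart Sc0.
have oI := open_chart_map_image cc0 oN' N'c0.
have [_ _ _ _ cK0] := cc0.
have cc := slice_chart_is_chart Gc; have [_ _ _ _ cK] := cc.
exists c0, c', N'; split=> //.
  move=> _ [Z [dZ NZ] <-]; rewrite (orbit_coset_local uC dZ); apply: Nc'.
  by exists (local_section C X Z).
have oIN := open_chart_map_image cc oN Nc.
have s1 : smooth_on (chart_map c0 @` N')
    (chart_map c \o (local_section C X \o chart_inv c0)).
  apply: (smooth_slice_chart_map Gc oI).
    by move=> _ [Z NZ <-] /=; rewrite cK0; [apply: Nc; case: NZ|exact: N'c0].
  by apply: smooth_on_set_val_section => // Z [].
have := smooth_on_comp oI oIN _ s1 sN.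
have H0 v : (chart_map c0 @` N') v -> (chart_map c @` N)
    ((chart_map c \o (local_section C X \o chart_inv c0)) v).
  move=> [Z NZ <-] /=; rewrite cK0; last exact: N'c0.
  by exists (local_section C X Z) => //; case: NZ.
move=> /(_ H0); apply: (smooth_on_ext oI) => _ [Z NZ <-] /=.
rewrite cK0; last exact: N'c0.
by rewrite cK; [rewrite -orbit_coset_local//; case: NZ|apply: Nc; case: NZ].
Qed.

(** The charts of the coset space are those of the orbit, carried by the
    homeomorphism between the two spaces. *)
Lemma homogeneous_structure_exists :
  exists (K : set (chart R H d)), homogeneous_structure dG K.
Proof.
pose tr := @transport_chart R H S d F F'.
have [cF cF'] := (@coset_orbit_continuous R n J C uC, @orbit_coset_continuous R n J C uJ uC).
have [FK F'K] := (@coset_orbitK R n J C uC, @orbit_cosetK R n J C uC).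
exists [set tr c | c in slice_charts (GL R n) S d].
have trc c : [set tr c | c in slice_charts (GL R n) S d] c -> is_chart c.
  move=> [c0 Sc0 <-]; apply: transport_is_chart => //.
  exact: slice_chart_is_chart Sc0.
have cval : continuous (set_val \o F).
  by move=> y; apply: continuous_comp; [exact: cF|exact: set_val_continuous].
split; first split; [| |split=> //|..].
- apply: (hausdorff_injective cval); last exact: norm_hausdorff.
  by move=> y z /val_inj; exact: coset_orbit_inj.
- apply: (second_countable_embedding cval); last exact: second_countable_mx.
  move=> U oU; have : open (F' @^-1` U) by apply: open_comp => // Y _; exact: cF'.
  move=> [V oV VU]; exists V => //; rewrite comp_preimage VU.
  by apply/seteqP; split=> y /=; rewrite FK.
- move=> y; have [c Sc dc] := orbit_charts (repr y).
  exists (tr c); first by exists c.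
  by rewrite /= dc; exact: section_dom_center.
- move=> _ _ [c Sc <-] [c' Sc' <-].
  have -> : chart_map (tr c) @` (chart_dom (tr c) `&` chart_dom (tr c'))
      = chart_map c @` (chart_dom c `&` chart_dom c').
    exact: transport_image.
  have cc := slice_chart_is_chart Sc; have cc' := slice_chart_is_chart Sc'.
  have [od _ _ _ cK] := cc; have [od' _ _ _ _] := cc'.
  have oI : open (chart_map c @` (chart_dom c `&` chart_dom c')).
    by apply: (open_chart_map_image cc) => [|Y []//]; exact: openI.
  have : smooth_on (chart_map c @` (chart_dom c `&` chart_dom c'))
      (chart_map c' \o chart_inv c).
    apply: (smooth_slice_chart_map Sc' oI).
      by move=> _ [Y [dY dY'] <-]; rewrite cK.
    apply: smooth_on_subset (smooth_slice_chart_inv Sc).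
    by move=> _ [Y [dY _] <-]; exists Y.
  by apply: (smooth_on_ext oI) => v _ /=; rewrite F'K.
- move=> X; have [c Sc dc] := orbit_charts X.
  have cc := slice_chart_is_chart cGP; have [_ _ _ _ cK] := cc.
  pose N : set G := @orbit_map R n J C @^-1` section_dom C X.
  have oN : open N.
    apply: open_comp; last exact: open_section_dom.
    by move=> Y _; exact: orbit_map_continuous.
  have Nc : N `<=` chart_dom cG by rewrite cGT.
  have oI := open_chart_map_image cc oN Nc.
  exists cG, (tr c), N; split=> //.
  + by split=> //; exists c.
  + by split=> //; exact: section_dom_center.
  + by move=> _ [Y NY <-] /=; rewrite dc coset_orbit_proj.
  have : smooth_on (chart_map cG @` N)
      (chart_map c \o (@orbit_map R n J C \o chart_inv cG)).
    apply: (smooth_slice_chart_map Sc oI).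
      by move=> _ [Y NY <-] /=; rewrite cK ?cGT// dc.
    have : smooth_on (chart_map cG @` N)
        (fun v => Gamma_hat (C *m (set_val \o chart_inv cG) v) J).
      apply: smooth_on_conj_orbit => //; first by move=> v _; exact: centralizer_unit.
      apply: smooth_on_subset (smooth_slice_chart_inv cGP).
      by move=> _ [Y NY <-]; exists Y => //; rewrite cGT.
    by apply: (smooth_on_ext oI).
  by apply: (smooth_on_ext oI) => v _ /=; rewrite coset_orbit_proj.
- move=> y; pose X := repr y; have [c Sc dc] := orbit_charts X.
  exists (F @^-1` section_dom C X), (local_section C X \o F).
  have oN : open (F @^-1` section_dom C X).
    by apply: open_comp; [move=> z _; exact: cF|exact: open_section_dom].
  split=> //; first exact: section_dom_center.
  - move=> z Nz; apply: (@smooth_at_slice _ _ _ _ _ _ _ _ _ trc _ _ (tr c) cG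
        (F @^-1` section_dom C X)) => //.
    + by exists c.
    + by rewrite /= dc.
    + by move=> w _; rewrite cGT.
    have oD : open (section_dom C X) by exact: open_section_dom.
    have := @smooth_on_set_val_section c X (section_dom C X) Sc oD _ _.
    rewrite dc => /(_ (fun _ => id) (fun _ => id)).
    rewrite transport_image//; apply: smooth_on_ext => [|v _ /=]; last by rewrite F'K.
    apply: (open_chart_map_image (slice_chart_is_chart Sc) oD).
    by rewrite dc.
  - move=> z Nz; apply: (coset_orbit_inj uC).
    by rewrite coset_orbit_proj // (local_sectionK uC Nz).
Qed.

End HomogeneousStructure.

(** Collects the geometric part. The spectrum enters only through
    [SR_spectrum_orbit], which identifies the orbit. *)
Theorem orbit_homogeneous (R : realType) (n : nat) (J C : 'M[R]_n) :
  J \in unitmx -> C \in unitmx ->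
  exists d dG : nat,
    [/\ embedded_submanifold (GL R n) (orbit J C) d,
        embedded_submanifold (GL R n) (centralizer (J *m J)) dG,
        exists e (K : set (chart R (homogeneous_space (J *m J) J) e)),
          homogeneous_structure dG K &
        forall e (K : set (chart R (homogeneous_space (J *m J) J) e)),
          homogeneous_structure dG K ->
          diffeomorphic K (slice_charts (GL R n) (orbit J C) d)].
Proof.
move=> uJ uC; have [d charts] := orbit_chart uJ uC.
have [dG [cG [cGP cGT]]] := centralizer_chart (J *m J).
have ocharts (X : centralizer (J *m J)) :
    exists2 c, slice_charts (GL R n) (orbit J C) d c &
      chart_dom c = section_dom C X.
  exact: charts (orbit_map C X) (set_valP X).
exists d, dG; split.
- split; [exact: open_GL|by move=> Y /(orbit_unit uJ uC)|move=> Y].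
  have [X XY] := coset_of_orbit_subproof Y.
  have [c Sc dc] := ocharts X; exists c => //.
  by rewrite dc -XY; exact: section_dom_center.
- split; [exact: open_GL|by move=> X []|move=> X].
  by exists cG; rewrite ?cGT.
- exists d; exact: (homogeneous_structure_exists uJ uC ocharts cGP cGT).
- move=> e K hK; exists (@coset_orbit R n J C), (@orbit_coset R n J C); split.
  + exact: coset_orbitK.
  + exact: orbit_cosetK.
  + exact: (smooth_coset_orbit uJ uC ocharts hK).
  + exact: (smooth_orbit_coset uJ uC ocharts hK).
Qed.

(** * Block-diagonal matrices of varying order *)

Section SizedMatrices.
Variable R : realType.

(** The Jordan forms of a square root and of its square are built with sums of
    sizes that are equal without being convertible. Bundling a square matrix
    with its order makes such matrices comparable by plain equality, and turns
    the block-diagonal sum into a monoid law, so that \mxdiag becomes an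
    iterated operator and squares, multiples and characteristic polynomials
    become morphisms. *)
Definition sized_mx := {n & 'M[R]_n}.

Definition sized n (X : 'M[R]_n) : sized_mx := Tagged (fun n => 'M[R]_n) X.

Implicit Types (x y z : sized_mx).

Definition sized_sum x y := sized (dsum (tagged x) (tagged y)).

Definition sized0 := sized (0 : 'M[R]_0).

Definition sized_sqr x := sized (tagged x *m tagged x).

Definition sized_scale (a : R) x := sized (a *: tagged x).

Definition sized_char_poly x := char_poly (complexify (tagged x)).

Lemma sized_cast m n (e : m = n) (X : 'M[R]_m) : sized (castmx (e, e) X) = sized X.
Proof. by case: _ / e. Qed.

Lemma sized_scalar m n (a : R) : m = n ->
  sized (a%:M : 'M[R]_m) = sized (a%:M : 'M[R]_n).
Proof. by move=> ->. Qed.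

Lemma sized_sumA : associative sized_sum.
Proof.
move=> [a X] [b Y] [c Z]; rewrite /sized_sum /= /dsum.
have := @block_mxA R a b c a b c X 0 0 0 Y 0 0 0 Z; rewrite /= !row_mx0 !col_mx0 => ->.
by rewrite (sized_cast (esym (addnA a b c))).
Qed.

Lemma sized_sum0x : left_id sized0 sized_sum.
Proof.
move=> [a X]; rewrite /sized_sum /sized0 /dsum /= /block_mx.
by rewrite !row_thin_mx col_flat_mx.
Qed.

Lemma sized_sumx0 : right_id sized0 sized_sum.
Proof.
move=> [a X]; rewrite /sized_sum /sized0 /= -(sized_cast (addn0 a)).
congr existT; apply/matrixP => i j; rewrite castmxE.
have cE (k : 'I_a) : cast_ord (esym (addn0 a)) k = lshift 0 k by exact: val_inj.
by rewrite !cE block_mxEul.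
Qed.

HB.instance Definition _ :=
  Monoid.isLaw.Build sized_mx sized0 sized_sum sized_sumA sized_sum0x sized_sumx0.

Lemma sized_mxdiag k (p_ : 'I_k -> nat) (B : forall i, 'M[R]_(p_ i)) :
  sized (\mxdiag_i B i) = \big[sized_sum/sized0]_(i < k) sized (B i).
Proof.
elim: k p_ B => [|k IHk] p_ B.
  rewrite big_ord0; have e : (\sum_(i < 0) p_ i = 0)%N by rewrite big_ord0.
  by rewrite -(sized_cast e) (flatmx0 (castmx _ _)).
by rewrite mxdiag_recl (sized_cast mxsize_recl) big_ord_recl -IHk.
Qed.

Lemma sized_sqr_sum x y :
  sized_sqr (sized_sum x y) = sized_sum (sized_sqr x) (sized_sqr y).
Proof.
rewrite /sized_sqr /sized_sum /dsum /= mulmx_block.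
by rewrite !mulmx0 !mul0mx !addr0 !add0r.
Qed.

Lemma sized_sqr_big k (f : 'I_k -> sized_mx) :
  sized_sqr (\big[sized_sum/sized0]_i f i) = \big[sized_sum/sized0]_i sized_sqr (f i).
Proof.
apply: (big_morph sized_sqr sized_sqr_sum).
by rewrite /sized_sqr /sized0 /= mul0mx.
Qed.

Lemma sized_scale_sum a x y :
  sized_scale a (sized_sum x y) = sized_sum (sized_scale a x) (sized_scale a y).
Proof. by rewrite /sized_scale /sized_sum /dsum /= scale_block_mx !scaler0. Qed.

Lemma sized_scale_big a k (f : 'I_k -> sized_mx) :
  sized_scale a (\big[sized_sum/sized0]_i f i) =
  \big[sized_sum/sized0]_i sized_scale a (f i).
Proof.
apply: (big_morph (sized_scale a) (sized_scale_sum a)).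
by rewrite /sized_scale /sized0 /= scaler0.
Qed.

Lemma sized_sqr_scale a x : sized_sqr (sized_scale a x) = sized_scale (a * a) (sized_sqr x).
Proof.
by rewrite /sized_sqr /sized_scale /= -scalemxAl -scalemxAr scalerA.
Qed.

Lemma sized_scalarZ a b n : sized_scale a (sized (b%:M : 'M[R]_n)) = sized ((a * b)%:M : 'M[R]_n).
Proof. by rewrite /sized_scale /= scale_scalar_mx. Qed.

Lemma sized_scalarM a n : sized_sqr (sized (a%:M : 'M[R]_n)) = sized ((a * a)%:M : 'M[R]_n).
Proof. by rewrite /sized_sqr /= -scalar_mxM. Qed.

Lemma sized_scalarD a m n :
  sized_sum (sized (a%:M : 'M[R]_m)) (sized (a%:M : 'M[R]_n)) = sized (a%:M : 'M[R]_(m + n)).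
Proof. by rewrite [in RHS]scalar_mx_block. Qed.

Lemma sized_char_poly_sum x y :
  sized_char_poly (sized_sum x y) = sized_char_poly x * sized_char_poly y.
Proof.
rewrite /sized_char_poly /char_poly /complexify /sized_sum /dsum /=.
rewrite map_block_mx !map_mx0 /char_poly_mx map_block_mx !map_mx0.
by rewrite scalar_mx_block opp_block_mx add_block_mx !oppr0 !addr0 det_ublock.
Qed.

Lemma sized_char_poly_big k (f : 'I_k -> sized_mx) :
  sized_char_poly (\big[sized_sum/sized0]_i f i) = \prod_i sized_char_poly (f i).
Proof.
apply: (big_morph sized_char_poly sized_char_poly_sum).
by rewrite /sized_char_poly /char_poly det_mx00.
Qed.

Lemma sized_char_poly_scalar a n :
  sized_char_poly (sized (a%:M : 'M[R]_n)) = ('X - (real_complex R a)%:P) ^+ n.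
Proof.
rewrite /sized_char_poly /char_poly /complexify /= map_scalar_mx /char_poly_mx.
by rewrite map_scalar_mx -raddfB /= det_scalar.
Qed.

Lemma sized_char_poly_rotation (r t : R) :
  sized_char_poly (sized_scale r (sized (rotation_mx t))) =
  ('X - (polar r t)%:P) * ('X - (polar r (- t))%:P).
Proof.
rewrite /sized_char_poly /char_poly (expand_det_row _ ord0).
rewrite !big_ord_recl big_ord0 addr0 /cofactor !det_mx11 !mxE /=.
rewrite /bump /= !addn0 expr0 expr1 !mulr1n !mulr0n.
have polarE v : polar r v = real_complex R (r * cos v) +
    real_complex R (r * sin v) * Complex 0 1.
  by apply/eqP; rewrite eq_complex /= !mulr0 !mul0r !mulr1 subr0 !addr0 add0r !eqxx.
rewrite !polarE cosN sinN mulrN rmorphN /= mulNr !(polyCD, polyCM, polyCN).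
move: ((real_complex R (r * cos t))%:P) ((real_complex R (r * sin t))%:P) => a b.
have jj : (Complex 0 1 : R[i])%:P * (Complex 0 1 : R[i])%:P = -1.
  by rewrite -polyCM -expr2 sqr_i polyCN.
move: ((Complex 0 1 : R[i])%:P) jj => j jj.
have -> : ('X - (a + b * j)) * ('X - (a + - b * j)) =
  ('X - a) * ('X - a) - b * b * (j * j) by ring.
by rewrite jj; ring.
Qed.

Lemma prod_flatten_image (T : comPzRingType) (I : finType) (S : Type) (f : I -> seq S)
  (g : S -> T) :
  \prod_(z <- flatten [seq f i | i : I]) g z = \prod_i \prod_(z <- f i) g z.
Proof. by rewrite big_flatten big_image. Qed.

Lemma prod_nseq (T : pzRingType) (S : Type) (g : S -> T) k s :
  \prod_(z <- nseq k s) g z = g s ^+ k.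
Proof. by rewrite big_nseq iter_mulr_1. Qed.

End SizedMatrices.

(** * Squares and spectra of the Jordan forms *)

Section Spectra.
Variables (R : realType) (n : nat).
Implicit Types M : 'M[R]_n.

(** Over the complex numbers the characteristic polynomial splits. *)
Lemma has_spectrumP M s : has_spectrum M s <->
  char_poly (complexify M) = \prod_(z <- s) ('X - z%:P).
Proof.
split=> [sM|sM z]; last by rewrite sM mu_prod_XsubC.
have [r rE] := closed_field_poly_normal (char_poly (complexify M)).
move: rE; rewrite (monicP (char_poly_monic _)) scale1r => rE.
rewrite rE; apply: perm_big; rewrite perm_sym.
by apply/allP => z _ /=; rewrite -sM rE mu_prod_XsubC.
Qed.

End Spectra.

Section JordanForms.
Variable (R : realType).

Lemma rotation_mxM (a b : R) :
  rotation_mx a *m rotation_mx b = rotation_mx (a + b).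
Proof.
apply/matrixP => i j; rewrite !mxE !big_ord_recl big_ord0 !mxE addr0 cosD sinD.
case: i j => -[|[|//]] ? [[|[|//]] ?] /=; ring.
Qed.

Lemma rotation_mx_pi : rotation_mx pi = (-1)%:M :> 'M[R]_2.
Proof.
apply/matrixP => i j; rewrite !mxE cospi sinpi oppr0 if_same.
by case: eqP.
Qed.

Lemma rotation_mx_2pi (t : R) : rotation_mx (t / 2 - pi + (t / 2 - pi)) = rotation_mx t.
Proof.
have -> : t / 2 - pi + (t / 2 - pi) = (t - pi) - pi by field.
apply/matrixP => i j; rewrite !mxE !(cosB, sinB) cospi sinpi.
by case: ifP => _; [|case: ifP => _]; ring.
Qed.

Lemma sized_rotation_sqr (t : R) :
  sized_sqr (sized (rotation_mx t)) = sized (rotation_mx (t + t)).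
Proof. by rewrite /sized_sqr /= rotation_mxM. Qed.

Lemma sized_big_cat (x : sized_mx R) a b c : (a + b = c)%N ->
  sized_sum (\big[@sized_sum R/sized0 R]_(j < a) x)
            (\big[@sized_sum R/sized0 R]_(j < b) x) =
  \big[@sized_sum R/sized0 R]_(j < c) x.
Proof. by move=> <-; rewrite [RHS]big_split_ord. Qed.

Lemma sized_conform m n (X : 'M[R]_m) : m = n ->
  sized (conform_mx (0 : 'M[R]_n) X) = sized X.
Proof. by move=> e; subst n; rewrite conform_mx_id. Qed.

Lemma sized_inj n : injective (@sized R n).
Proof.
move=> X Y /(congr1 (fun x => conform_mx (0 : 'M[R]_n) (tagged x))).
by rewrite /= !conform_mx_id.
Qed.

Variable D : eigen_data R.
Local Notation sb := (@sized_sum R).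
Local Notation s0 := (sized0 R).

Lemma sized_RJS_blocks : sized (RJS_blocks D) =
  sb (\big[sb/s0]_(i < pos_num D) sized ((lam i)%:M : 'M[R]_(hmul i)))
  (sb (\big[sb/s0]_(l < arg_num D) \big[sb/s0]_(t < mod_num l)
        sized_scale (rho t) (\big[sb/s0]_(j < mmul t) sized (rotation_mx (theta l))))
      (\big[sb/s0]_(i < neg_num D) sized ((- zeta i)%:M : 'M[R]_(2 * kmul i)))).
Proof.
rewrite -[LHS]/(sb (sized _) (sb (sized _) (sized _))) !sized_mxdiag.
congr (sb _ (sb _ _)); apply: eq_bigr => l _; rewrite sized_mxdiag.
apply: eq_bigr => t _; rewrite -sized_mxdiag.
by [].
Qed.

Variable u : 'I_(pos_num D) -> nat.
Variable mu : forall l : 'I_(arg_num D), 'I_(mod_num l) -> nat.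

Lemma sized_RJA_blocks : sized (RJA_blocks u mu) =
  sb (\big[sb/s0]_(i < pos_num D) sized_scale (Num.sqrt (lam i))
        (sb (sized (1%:M : 'M[R]_(u i))) (sized ((-1)%:M : 'M[R]_(hmul i - u i)))))
  (sb (\big[sb/s0]_(l < arg_num D) \big[sb/s0]_(t < mod_num l)
        sized_scale (Num.sqrt (rho t))
          (sb (\big[sb/s0]_(j < mu t) sized (rotation_mx (theta l / 2)))
              (\big[sb/s0]_(j < mmul t - mu t) sized (rotation_mx (theta l / 2 - pi)))))
      (\big[sb/s0]_(i < neg_num D) sized_scale (Num.sqrt (zeta i))
          (\big[sb/s0]_(j < kmul i) sized (rotation_mx (pi / 2))))).
Proof.
rewrite -[LHS]/(sb (sized _) (sb (sized _) (sized _))) !sized_mxdiag.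
congr (sb _ (sb _ _)); apply: eq_bigr => l _.
- by rewrite raddfN.
- rewrite sized_mxdiag; apply: eq_bigr => t _; rewrite -!sized_mxdiag.
  by [].
- by rewrite -sized_mxdiag.
Qed.

Hypothesis D_wf : eigen_data_wf D.
Hypothesis u_mu : admissible u mu.

(** Blockwise: the opposite square roots of lam have the same square, so do the
    rotations of angles theta / 2 and theta / 2 - pi, which differ by a half
    turn, and a quarter turn squares to -1. *)
Lemma sized_sqr_RJA_blocks : sized_sqr (sized (RJA_blocks u mu)) = sized (RJS_blocks D).
Proof.
have [[_ lam0 _] _ rho_wf [_ zeta0 _]] := D_wf; have [hu hmu] := u_mu.
rewrite sized_RJA_blocks sized_RJS_blocks !sized_sqr_sum !sized_sqr_big.
congr (sb _ (sb _ _)); apply: eq_bigr => l _.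
- rewrite sized_sqr_scale -expr2 sqr_sqrtr ?ltW// sized_sqr_sum !sized_scalarM.
  rewrite mulrNN !mulr1 sized_scalarD sized_scalarZ mulr1.
  by apply: sized_scalar; rewrite subnKC.
- rewrite sized_sqr_big; apply: eq_bigr => t _; have [_ rho0 _] := rho_wf l.
  rewrite sized_sqr_scale -expr2 sqr_sqrtr ?ltW// sized_sqr_sum !sized_sqr_big.
  rewrite !sized_rotation_sqr rotation_mx_2pi -splitr (sized_big_cat _ (subnKC _))//.
- rewrite sized_sqr_scale -expr2 sqr_sqrtr ?ltW// sized_sqr_big.
  rewrite !sized_rotation_sqr -splitr rotation_mx_pi -sized_mxdiag mxdiagZ.
  rewrite sized_scalarZ mulrN1; apply: sized_scalar.
  by rewrite sum_nat_const card_ord mulnC.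
Qed.

Lemma sized_char_poly_RJA_blocks : sized_char_poly (sized (RJA_blocks u mu)) =
  \prod_(z <- root_eigenvalues u mu) ('X - z%:P).
Proof.
rewrite sized_RJA_blocks !sized_char_poly_sum !sized_char_poly_big.
rewrite /root_eigenvalues !big_cat /= !prod_flatten_image.
congr (_ * (_ * _)); apply: eq_bigr => l _.
- rewrite sized_scale_sum !sized_scalarZ sized_char_poly_sum !sized_char_poly_scalar.
  by rewrite mulr1 mulrN1 big_cat /= !prod_nseq rmorphN.
- rewrite sized_char_poly_big prod_flatten_image; apply: eq_bigr => t _.
  rewrite sized_scale_sum !sized_scale_big sized_char_poly_sum !sized_char_poly_big.
  rewrite !big_cat /= !prod_nseq !sized_char_poly_rotation.
  by rewrite !prodr_const !card_ord !exprMn -!mulrA.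
- rewrite sized_scale_big sized_char_poly_big sized_char_poly_rotation.
  rewrite big_cat /= !prod_nseq prodr_const card_ord exprMn.
  by rewrite /polar cosN sinN cos_pihalf sin_pihalf mulr0 mulr1 mulrN mulr1.
Qed.

Lemma RJA_sqr n : RJS_order D = n ->
  RJA u mu n *m RJA u mu n = RJS D n.
Proof.
move=> eS; have eA : RJA_order u mu = n by rewrite RJA_order_eq.
apply: sized_inj.
rewrite /RJA /RJS [RHS]sized_conform// -sized_sqr_RJA_blocks.
by rewrite -(sized_conform _ eA).
Qed.

Lemma RJA_spectrum n : RJS_order D = n ->
  has_spectrum (RJA u mu n) (root_eigenvalues u mu).
Proof.
move=> eS; have eA : RJA_order u mu = n by rewrite RJA_order_eq.
apply/has_spectrumP; rewrite -sized_char_poly_RJA_blocks.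
by rewrite -(sized_conform _ eA).
Qed.

End JordanForms.

(** * Similarity of diagonalizable square roots *)

Lemma char_poly_similar (F : fieldType) n (P X Y : 'M[F]_n) : P \in unitmx ->
  P *m X = Y *m P -> char_poly X = char_poly Y.
Proof.
move=> uP PXY; pose Pp : 'M[{poly F}]_n := map_mx polyC P.
have detP : \det Pp != 0.
  by rewrite det_map_mx polyC_eq0 -unitfE -unitmxE.
apply: (mulfI detP); rewrite [RHS]mulrC -!det_mulmx; congr (\det _).
rewrite mulmxBr mulmxBl -!map_mxM PXY; congr (_ - _).
by rewrite scalar_mxC.
Qed.

Section DiagonalizableSquareRoot.
Variable (F : numClosedFieldType).

(** If A = Z^2 is diagonalizable and invertible it is annihilated by a product
    of distinct X - a with a nonzero. Then [Z] is annihilated by the product of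
    the X^2 - a, whose roots, the two square roots of each a, are distinct. *)
Lemma diagonalizable_sqrt n (Z : 'M[F]_n) :
  Z \in unitmx -> diagonalizable (Z *m Z) -> diagonalizable Z.
Proof.
case: n Z => [|n] Z uZ; first by rewrite (thinmx0 Z) => _; exact: diagonalizable0.
move=> /diagonalizableP[rs urs].
rewrite dvd_mxminpoly (bigID (pred1 0))/= (eq_bigr (fun=> 'X)); last first.
  by move=> x /eqP->; rewrite subr0.
rewrite big_const_seq iter_mulr_1 rmorphM rmorphXn /= horner_mx_X => /eqP.
set k := count _ _; rewrite -big_filter; set rs' := seq.filter _ _ => Zrs.
have uZZ : (Z *m Z) ^+ k \in unitmx by apply: unitrX; rewrite -[_ \is a _]/(_ \in unitmx) unitmx_mul uZ.
(* Z^2 is invertible, so the factor X^k of its annihilator can be dropped. *)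
have {Zrs} : horner_mx (Z *m Z) (\prod_(x <- rs') ('X - x%:P)) = 0.
  by apply: (can_inj (mulKmx uZZ)); rewrite mulmx0; exact: Zrs.
have rs'0 x : x \in rs' -> x != 0 by rewrite mem_filter => /andP[].
have {urs} : uniq rs' by exact: filter_uniq.
move: rs' rs'0 => s s0 us Zs.
have sqrt_inj : injective (fun x : F => sqrtC x).
  by move=> x y xy; rewrite -[x]sqrtCK xy sqrtCK.
apply/diagonalizableP.
exists ([seq sqrtC x | x <- s] ++ [seq - sqrtC x | x <- s]).
  rewrite cat_uniq (map_inj_uniq sqrt_inj) us /=.
  rewrite (map_inj_uniq (inj_comp oppr_inj sqrt_inj)) us andbT.
  apply/hasPn => _ /mapP[x xs ->]; apply/negP => /mapP[y ys xy].
  have exy : x = y by rewrite -[x]sqrtCK -[y]sqrtCK -xy sqrrN.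
  move/eqP: xy; rewrite -exy eq_sym -addr_eq0 -mulr2n mulrn_eq0 /=.
  by rewrite sqrtC_eq0 (negPf (s0 _ xs)).
rewrite dvd_mxminpoly big_cat /= !big_map -big_split /=.
rewrite -Zs !rmorph_prod; apply/eqP; apply: eq_bigr => x _.
rewrite polyCN opprK -subr_sqr -polyC_exp sqrtCK.
by rewrite !rmorphB rmorphXn /= !horner_mx_X !horner_mx_C expr2.
Qed.

(** The eigenvalues, read off the characteristic polynomials, agree up to a
    permutation, whose matrix conjugates the diagonal forms. *)
Lemma diagonalizable_similar n (X Y : 'M[F]_n) :
  diagonalizable X -> diagonalizable Y -> char_poly X = char_poly Y ->
  exists2 P, P \in unitmx & P *m X = Y *m P.
Proof.
have diagE (Z : 'M[F]_n) : diagonalizable Z ->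
    exists P (d : 'rV[F]_n), [/\ P \in unitmx, P *m Z = diag_mx d *m P &
      char_poly Z = \prod_(x <- [tuple d 0 i | i < n]) ('X - x%:P)].
  move=> [P uP /(diagonalizable_forLR uP)[d ->]]; exists P, d.
  have E : P *m conjmx (invmx P) (diag_mx d) = diag_mx d *m P.
    by rewrite conjVmx// -mulmxA mulKVmx.
  split=> //; rewrite (char_poly_similar uP E) char_poly_trig ?diag_mx_is_trig//.
  rewrite big_tuple; apply: eq_bigr => i _.
  by rewrite tnth_mktuple mxE eqxx.
move=> /diagE[P [d [uP PX cX]]] /diagE[Q [d' [uQ QY cY]]].
rewrite cX cY => /prod_XsubC_eq/tuple_permP[s sE].
have dE i : d 0 i = d' 0 (s i).
  have := congr1 (fun t => nth 0 t i) sE.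
  rewrite -[LHS]/(nth 0 [tuple d 0 i | i < n] i) -!tnth_nth !tnth_mktuple.
  by [].
have sd : diag_mx d *m perm_mx s = perm_mx s *m diag_mx d'.
  rewrite -row_permE; apply/matrixP => i j; rewrite mul_diag_mx !mxE dE.
  by rewrite mulr_natr; case: eqP => [->|//].
exists (invmx Q *m (perm_mx s)^T *m P).
  by rewrite !unitmx_mul unitmx_inv uQ unitmx_tr unitmx_perm uP.
rewrite -!mulmxA PX; apply: (can_inj (mulKmx uQ)); rewrite !mulmxA mulmxV// mul1mx.
rewrite QY -!mulmxA (mulmxA Q) mulmxV// mul1mx !mulmxA; congr (_ *m P).
apply: (can_inj (mulKmx (unitmx_perm _ s))).
rewrite !mulmxA -sd tr_perm_mx -perm_mxM mulgV perm_mx1 mul1mx.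
by rewrite -mulmxA -perm_mxM mulgV perm_mx1 mulmx1.
Qed.

End DiagonalizableSquareRoot.

Section RealSimilarity.
Variables (R : realType) (n : nat).
Implicit Types (X Y : 'M[R]_n).

Lemma complexify_eq0 X Y :
  complexify X + 'i%C *: complexify Y = 0 -> X = 0 /\ Y = 0.
Proof.
move=> XY0; split; apply/matrixP => i j; move/matrixP/(_ i j): XY0;
  rewrite !mxE /= => /eqP; rewrite eq_complex /=.
  by rewrite !(mul0r, mul1r, mulr0, subr0, addr0, add0r) => /andP[/eqP].
by rewrite !(mul0r, mul1r, mulr0, subr0, addr0, add0r) => /andP[_ /eqP].
Qed.

Lemma complexifyM X Y : complexify (X *m Y) = complexify X *m complexify Y.
Proof. exact: map_mxM. Qed.

Lemma complex_mx_decomp (P : 'M[R[i]]_n) : exists P1 P2 : 'M[R]_n,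
  P = complexify P1 + 'i%C *: complexify P2.
Proof.
exists (map_mx (@complex.Re R) P), (map_mx (@complex.Im R) P).
apply/matrixP => i j; rewrite !mxE; case: (P i j) => a b.
by apply/eqP; rewrite eq_complex /= !(mul0r, mul1r, mulr0, subr0, addr0, add0r) !eqxx.
Qed.

(** Similarity descends from the complex to the real numbers: the real and
    imaginary parts P1, P2 of a conjugating matrix both intertwine [X] and [Y],
    hence so does P1 + t P2 for every real t. The polynomial det (P1 + t P2)
    does not vanish at t = i, so it is nonzero, and some real t is not one of
    its roots. *)
Lemma real_similar X Y (P : 'M[R[i]]_n) : P \in unitmx ->
  P *m complexify X = complexify Y *m P ->
  exists2 Q : 'M[R]_n, Q \in unitmx & Q *m X = Y *m Q.
Proof.
have [P1 [P2 ->]] := complex_mx_decomp P => uP.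
rewrite mulmxDl mulmxDr -scalemxAl -scalemxAr -!complexifyM => PXY.
have [/eqP P1E /eqP P2E] : P1 *m X - Y *m P1 = 0 /\ P2 *m X - Y *m P2 = 0.
  apply: complexify_eq0; rewrite /complexify !map_mxB scalerBr addrACA.
  by rewrite -opprD; apply/eqP; rewrite subr_eq0; apply/eqP.
move: P1E P2E; rewrite !subr_eq0 => /eqP P1E /eqP P2E.
pose M : 'M[{poly R}]_n := map_mx polyC P1 + 'X *: map_mx polyC P2.
have ME t : (\det M).[t] = \det (P1 + t *: P2).
  rewrite -[LHS]/(horner_eval t _) -det_map_mx; congr (\det _).
  apply/matrixP => i j; rewrite !mxE /=.
  by rewrite -[LHS]/(horner _ t) !hornerE.
have [t tP] : exists t, \det (P1 + t *: P2) != 0.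
  apply: contrapT => noroot.
  have M0 : \det M = 0.
    apply: (@roots_geq_poly_eq0 _ _ [seq i%:R | i <- iota 0 (size (\det M))]).
    - apply/allP => x _; rewrite /root ME; apply: contrapT => /negP tx.
      by apply: noroot; exists x.
    - rewrite map_inj_uniq ?iota_uniq// => i j /eqP; rewrite eqr_nat => /eqP//.
    - by rewrite size_map size_iota.
  have : \det (complexify P1 + 'i%C *: complexify P2) = 0.
    have := congr1 (fun q => (map_poly (real_complex R) q).['i%C]) M0.
    rewrite rmorph0 horner0 => <-.
    rewrite -[RHS]/(horner_eval 'i%C (map_poly _ _)) -!det_map_mx; congr (\det _).
    apply/matrixP => i j; rewrite !mxE /=.
    rewrite rmorphD rmorphM /= map_polyX !map_polyC /=.
    by rewrite -[RHS]/(horner _ _) !hornerE.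
  by move/eqP; rewrite -[_ == 0]negbK -unitfE -unitmxE uP.
exists (P1 + t *: P2); first by rewrite unitmxE unitfE.
by rewrite mulmxDl mulmxDr -scalemxAl -scalemxAr P1E P2E.
Qed.

End RealSimilarity.

(** * The square roots with a given spectrum *)

Section SquareRoots.
Variables (R : realType) (n : nat).
Implicit Types (M J C X Y : 'M[R]_n).

Lemma has_spectrum_Gamma_hat C J s : C \in unitmx ->
  has_spectrum (Gamma_hat C J) s <-> has_spectrum J s.
Proof.
move=> uC; have uCc : complexify C \in unitmx by rewrite map_unitmx.
have E : char_poly (complexify J) = char_poly (complexify (Gamma_hat C J)).
  apply: (char_poly_similar uCc); rewrite -!complexifyM.
  by rewrite -Gamma_hat_def.
by rewrite !has_spectrumP E.
Qed.

Lemma SR_unit M Y : M \in unitmx -> SR M Y -> Y \in unitmx.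
Proof. by move=> uM YM; move: uM; rewrite -YM unitmx_mul => /andP[]. Qed.

Lemma SR_diagonalizable M Y : M \in unitmx -> semisimple M -> SR M Y ->
  diagonalizable (complexify Y).
Proof.
move=> uM ssM YM; apply: diagonalizable_sqrt.
  by rewrite map_unitmx; exact: SR_unit YM.
by rewrite -complexifyM YM.
Qed.

(** Both [Y] and Y0 = C J C^-1 are diagonalizable square roots of [M] with the
    same spectrum, so Y = Q Y0 Q^-1 for some real [Q]. Then X = C^-1 Q C sends
    [J] to C^-1 Y C, and it commutes with J^2 because Y^2 = Y0^2. *)
Lemma SR_spectrum_orbit M J C s : semisimple M -> J \in unitmx -> C \in unitmx ->
  M = Gamma_hat C (J *m J) -> has_spectrum J s ->
  [set Y | SR M Y /\ has_spectrum Y s] = orbit J C.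
Proof.
move=> ssM uJ uC MJ Js; apply/seteqP; split=> Y; last first.
  move=> oY; split; first by rewrite MJ; exact: orbit_sqr.
  have [X cX <-] := oY; apply/has_spectrum_Gamma_hat => //; exact: (mul_centralizer_unit uC cX).
have uM : M \in unitmx by rewrite MJ Gamma_hat_unit// unitmx_mul uJ.
move=> [YM Ys]; pose Y0 := Gamma_hat C J.
have Y0M : SR M Y0 by rewrite /SR /= Gamma_hat_mul.
have /has_spectrumP Y0s : has_spectrum Y0 s by exact/has_spectrum_Gamma_hat.
move/has_spectrumP : Ys; rewrite -Y0s => /esym cY.
have [P uP PY] := diagonalizable_similar (SR_diagonalizable uM ssM Y0M)
  (SR_diagonalizable uM ssM YM) cY.
have [Q uQ QY] := real_similar uP PY.
have YE : Gamma_hat (Q *m C) J = Y by rewrite -Gamma_hat_comp//; exact: Gamma_hat_eq.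
have uQC : Q *m C \in unitmx by rewrite unitmx_mul uQ.
exists (invmx C *m (Q *m C)); last by rewrite mulKVmx.
by apply/Gamma_hat_eqP => //; rewrite -MJ -YM -Gamma_hat_mul ?YE.
Qed.

(** A limit Y0 of such matrices is a square root of [M]. Those [Y] that are
    close to Y0 are such that Y + Y0 is invertible, hence are conjugate to Y0
    by [sqr_conj_add], and Y0 has the same spectrum as they have. *)
Lemma closed_SR_spectrum M s : M \in unitmx ->
  closed [set Y | SR M Y /\ has_spectrum Y s].
Proof.
move=> uM Y0 clY0.
have sqr_cont : continuous (fun Y : 'M[R]_n => Y *m Y).
  move=> Y; have : smooth_on setT (fun Y : 'M[R]_n => Y *m Y).
    by apply: smooth_on_mulmx; [exact: openT|exact: smooth_on_id..].
  by move/smooth_on_continuous; exact.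
have cSR : closed (SR M).
  rewrite (_ : SR M = (fun Y => Y *m Y) @^-1` [set M])//.
  apply: closed_comp => [Y _|]; first exact: sqr_cont.
  exact/accessible_closed_set1/hausdorff_accessible/norm_hausdorff.
have Y0M : SR M Y0 by apply: cSR; apply: closureS clY0 => Y [].
have uY0 := SR_unit uM Y0M; split=> //.
have oU : open [set Y | Y + Y0 \in unitmx].
  apply: open_preimage_unitmx; apply: smooth_onD; first exact: openT.
    exact: smooth_on_id.
  exact: smooth_on_cst.
have [|Y [[YM Ys] uYY0]] := clY0 [set Y | Y + Y0 \in unitmx].
  apply: open_nbhs_nbhs; split=> //=.
  by rewrite -mulr2n -scaler_nat unitmxZ// unitfE pnatr_eq0.
have YE : Gamma_hat (Y + Y0) Y0 = Y.
  by apply: Gamma_hat_eq => //; rewrite sqr_conj_add// YM.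
by have [H _] := has_spectrum_Gamma_hat Y0 s uYY0; apply: H; rewrite YE.
Qed.

End SquareRoots.

Theorem proposition2p3 (R : realType) (n : nat) (M : 'M[R]_n)
    (M_GL : GL R n M) (M_semisimple : semisimple M)
    (M_even : negative_eigenvalues_even M)
    (D : eigen_data R) (D_wf : eigen_data_wf D)
    (D_M : has_spectrum M (eigenvalues D))
    (C : 'M[R]_n) (C_GL : GL R n C)
    (C_M : M = C *m RJS D n *m invmx C)
    (u : 'I_(pos_num D) -> nat)
    (mu : forall l : 'I_(arg_num D), 'I_(mod_num l) -> nat)
    (u_mu : admissible u mu) :
  [/\ SR_index u mu M =
        [set C *m X *m RJA u mu n *m invmx X *m invmx C
           | X in centralizer (RJS D n)],
      [set C *m X *m RJA u mu n *m invmx X *m invmx C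
           | X in centralizer (RJS D n)] =
        Gamma_hat C @`
          [set X *m RJA u mu n *m invmx X | X in centralizer (RJS D n)] &
      exists d dG : nat,
        [/\ embedded_submanifold (GL R n) (SR_index u mu M) d,
            closed (set_val @^-1` SR_index u mu M : set (GL R n)),
            embedded_submanifold (GL R n) (centralizer (RJS D n)) dG,
            exists e (K : set (chart R (homogeneous_space (RJS D n) (RJA u mu n)) e)),
              homogeneous_structure dG K &
            forall e (K : set (chart R (homogeneous_space (RJS D n) (RJA u mu n)) e)),
              homogeneous_structure dG K ->
              diffeomorphic K (slice_charts (GL R n) (SR_index u mu M) d)]].
Proof.
have eS := RJS_order_eq D_M.
have clS := @closed_SR_spectrum R n M (root_eigenvalues u mu) M_GL.
have JJ := RJA_sqr D_wf u_mu eS; have Js := RJA_spectrum u_mu eS.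
have uJ : RJA u mu n \in unitmx.
  have : Gamma_hat C (RJS D n) \in unitmx by rewrite /Gamma_hat -C_M.
  by rewrite Gamma_hat_unit// -JJ unitmx_mul => /andP[].
rewrite -JJ in C_M *.
move: (RJA u mu n) uJ Js C_M => J uJ Js C_M.
have SE := SR_spectrum_orbit M_semisimple uJ C_GL C_M Js.
have orbitE : [set C *m X *m J *m invmx X *m invmx C
    | X in centralizer (J *m J)] = orbit J C.
  apply: eq_imagel => X [uX _].
  by rewrite -Gamma_hat_comp// /Gamma_hat !mulmxA.
split.
- by rewrite orbitE.
- by rewrite image_comp; apply: eq_imagel => X _; rewrite /Gamma_hat /= !mulmxA.
have [d [dG [embS embG exK uniqK]]] := orbit_homogeneous uJ C_GL.
rewrite /SR_index SE in clS *; exists d, dG; split=> //.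
by apply: closed_comp clS => X _; exact: set_val_continuous.
Qed.
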